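(* Suppose that $\mathcal{H}^1(S_\lambda)<\infty$ for all $\lambda\in[0,a)$. Let $C>0$ and let $(\gamma_j)\subset\Gamma_C$ be a sequence of paths with constant speed that converges uniformly on $I$ to some $\gamma$. Then $$L(\gamma)\le\liminf_j L(\gamma_j).$$
   Context: $I=[0,1]$, $\mathcal{C}=[-1,1]^n$. A set is countably $1$-rectifiable if it is a countable union of Lipschitz images of bounded subsets of $\mathbb{R}$. Fixed: $S\subset\mathcal{C}$ countably $1$-rectifiable and Borel measurable, $a\in[0,\infty]$, $b:S\to[0,\infty)$ lower semi-continuous with $b\le a$ on $S$; $b$ is extended to $\mathcal{C}$ by $b=a$ on $\mathcal{C}\setminus S$. $S_\lambda=\{z\in S\,|\,b(z)\le\lambda\}$. $\Gamma_C$ is the set of Lipschitz paths $\gamma:I\to\mathcal{C}$ with Lipschitz constant at most $C$. A path has constant speed if $|\dot\gamma|$ is Lebesgue-a.e. equal to a constant. The path length is $L(\gamma)=\int_I b(\gamma)|\dot\gamma|\,\mathrm{d}\mathcal{L}$ ($\mathcal{L}$ Lebesgue measure, convention $0\cdot\infty=0$). *)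

(* Defs.v *)
From mathcomp Require Import all_boot all_order all_algebra.
From mathcomp Require Import all_classical all_reals all_analysis.
Import Order.TTheory GRing.Theory Num.Theory.
Import numFieldNormedType.Exports.

Set Implicit Arguments.
Unset Strict Implicit.
Unset Printing Implicit Defensive.

Local Open Scope classical_set_scope.
Local Open Scope ring_scope.

(* The library norm on ['rV[R]_n] is the sup norm; all metric notions below
   (speed, Lipschitz constants, diameters) are Euclidean. The topology, the
   uniform structure and the derivative do not depend on the choice of norm. *)
Definition enorm (R : realType) (n : nat) (x : 'rV[R]_n) : R :=
  Num.sqrt (\sum_(i < n) x ord0 i ^+ 2).

Definition cube (R : realType) (n : nat) : set 'rV[R]_n :=
  [set x | forall i : 'I_n, -1 <= x ord0 i <= 1].

Definition elipschitz_in (R : realType) (n : nat) (A : set R) (K : R)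
    (f : R -> 'rV[R]_n) : Prop :=
  forall s t, A s -> A t -> enorm (f s - f t) <= K * `|s - t|.

(* The sets [A k] may be empty, so finite unions are included. *)
Definition countably_1_rectifiable (R : realType) (n : nat)
    (S : set 'rV[R]_n) : Prop :=
  exists (A : nat -> set R) (f : nat -> R -> 'rV[R]_n),
    (forall k, bounded_set (A k) /\ exists K, elipschitz_in (A k) K (f k)) /\
    S = \bigcup_k (f k @` A k).

(* The maximum with 0 only serves to give the empty set diameter 0. *)
Definition ediam (R : realType) (n : nat) (A : set 'rV[R]_n) : \bar R :=
  maxe 0%E (ereal_sup [set (enorm (x - y))%:E | x in A & y in A]).

Definition hausdorff1_pre (R : realType) (n : nat) (d : R)
    (A : set 'rV[R]_n) : \bar R :=
  ereal_inf [set (\sum_(0 <= k <oo) ediam (U k))%E |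
    U in [set U : nat -> set 'rV[R]_n |
      A `<=` \bigcup_k U k /\ forall k, (ediam (U k) <= d%:E)%E]].

(* One-dimensional Hausdorff measure: the normalising constant is 1, so that it
   agrees with Lebesgue measure on lines. *)
Definition hausdorff1 (R : realType) (n : nat) (A : set 'rV[R]_n) : \bar R :=
  ereal_sup [set hausdorff1_pre d A | d in [set d : R | 0 < d]].

Definition borel_set (R : realType) (n : nat) (A : set 'rV[R]_n) : Prop :=
  <<s [set U : set 'rV[R]_n | open U] >> A.

Definition sublevel (R : realType) (n : nat) (S : set 'rV[R]_n)
    (b : 'rV[R]_n -> R) (l : R) : set 'rV[R]_n :=
  [set z | S z /\ b z <= l].

(* [b] is only meaningful on [S]. *)
Definition extend_cost (R : realType) (n : nat) (S : set 'rV[R]_n)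
    (a : \bar R) (b : 'rV[R]_n -> R) (z : 'rV[R]_n) : \bar R :=
  if z \in S then (b z)%:E else a.

(* Paths are total functions on [R], of which only the values on [0, 1] are
   constrained or (up to the two endpoints, for derivatives) used. *)
Definition Gamma (R : realType) (n : nat) (C : R) : set (R -> 'rV[R]_n) :=
  [set g | (forall t, `[0, 1]%classic t -> cube (g t)) /\
           elipschitz_in `[0, 1] C g].

Definition constant_speed (R : realType) (n : nat) (g : R -> 'rV[R]_n) : Prop :=
  exists c : R, {ae @lebesgue_measure R,
    forall t, `[0, 1]%classic t -> enorm (derive1 g t) = c}.

(* In [\bar R], [0 * +oo = 0]. *)
Definition path_length (R : realType) (n : nat) (S : set 'rV[R]_n)
    (a : \bar R) (b : 'rV[R]_n -> R) (g : R -> 'rV[R]_n) : \bar R :=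
  (\int[@lebesgue_measure R]_(t in `[0%R, 1%R])
     (extend_cost S a b (g t) * (enorm (derive1 g t))%:E))%E.

(* Main.v *)
From HB Require Import structures.
Require Import Defs.
From mathcomp Require Import all_boot all_order all_algebra.
From mathcomp Require Import all_classical all_reals all_analysis.
From mathcomp Require Import measurable_realfun ring lra.
Import Order.TTheory GRing.Theory Num.Theory.
Import numFieldNormedType.Exports.

(** Slicing the cost into layers, [b(z) = \int_0^a 1_(l < b(z)) dl], and using
    that the inferior limit of a sum is at least the sum of the inferior limits,
    one is reduced to a single level [l < a]: with [A = S_l], a set of finite
    Hausdorff measure, the length of [g] outside [A] is at most the inferior
    limit of the lengths of [gs j] outside [A].

    A path [gs j] close to [g] may run many times through a tiny piece of [A],
    so its length inside [A] is not controlled. What is controlled is the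
    measure of its image. On a time interval [[s, t]] this measure is at least
    the displacement [|gs j t - gs j s|] ([le_hausdorff1_arc]). The part of the
    image in [A] lies in a shrinking neighbourhood of the arc of [g]; as [A] has
    finite measure, its measure tends to at most that of [A] on the arc of [g]
    ([hausdorff1_enbhd]), which is at most [C] times the time spent by [g] in
    [A] ([hausdorff1_lipschitz_image]). The part outside [A] has measure at most
    [c j] times the time spent by [gs j] outside [A], because a path of constant
    speed [c j] is [c j]-Lipschitz ([constant_speed_lipschitz]); this product is
    exactly the length of [gs j] outside [A] during [[s, t]]. Hence
    ([near_displacement_le]) the inferior limit of that length is at least
    [|g t - g s| - C m], where [m] is the time spent by [g] in [A].

    Summing over [N] equal subintervals of [[0, 1]] bounds the inferior limit
    from below by the integral of a step function. As [N] grows, at almost every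
    time [t] with [g t] outside [A] the difference quotients tend to [|g' t|]
    and the density at [t] of the times spent in [A] vanishes, so Fatou's lemma
    gives the inequality for the level ([integral_uncovered_le_liminf]). A
    second use of Fatou's lemma, over finer and finer layers, gives the theorem.

    That constant speed is a Lipschitz constant, also for speed zero, rests on
    the fundamental theorem of calculus for Lipschitz functions
    ([lipschitz_density]): adding a linear function makes them nondecreasing,
    and the resulting Stieltjes measure has a density with respect to the
    Lebesgue measure by the Radon-Nikodym theorem. *)

Set Implicit Arguments.
Unset Strict Implicit.
Unset Printing Implicit Defensive.

Local Open Scope classical_set_scope.
Local Open Scope ring_scope.

(** * The Euclidean norm *)

Section enorm_theory.
Context {R : realType} {n : nat}.
Implicit Types x y z : 'rV[R]_n.

Definition edot x y : R := \sum_(i < n) x ord0 i * y ord0 i.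

Lemma enorm_ge0 x : 0 <= enorm x.
Proof. exact: sqrtr_ge0. Qed.

Lemma sqr_enorm x : enorm x ^+ 2 = edot x x.
Proof.
rewrite sqr_sqrtr; first by apply: eq_bigr => i _; rewrite expr2.
by apply: sumr_ge0 => i _; exact: sqr_ge0.
Qed.

Lemma enorm0 : enorm (0 : 'rV[R]_n) = 0.
Proof. by rewrite /enorm big1 ?sqrtr0// => i _; rewrite mxE expr0n. Qed.

Lemma enormZ (k : R) x : enorm (k *: x) = `|k| * enorm x.
Proof.
rewrite /enorm -sqrtr_sqr -sqrtrM ?sqr_ge0// mulr_sumr.
by congr Num.sqrt; apply: eq_bigr => i _; rewrite mxE exprMn.
Qed.

Lemma enormN x : enorm (- x) = enorm x.
Proof. by rewrite -scaleN1r enormZ normrN1 mul1r. Qed.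

Lemma enorm_distC x y : enorm (x - y) = enorm (y - x).
Proof. by rewrite -enormN opprB. Qed.

Lemma edotC x y : edot x y = edot y x.
Proof. by apply: eq_bigr => i _; rewrite mulrC. Qed.

Lemma edotBr x y z : edot x (y - z) = edot x y - edot x z.
Proof. by rewrite -sumrB; apply: eq_bigr => i _; rewrite !mxE mulrBr. Qed.

Lemma edotDr x y z : edot x (y + z) = edot x y + edot x z.
Proof. by rewrite -big_split; apply: eq_bigr => i _; rewrite !mxE mulrDr. Qed.

Lemma edotZr k x y : edot x (k *: y) = k * edot x y.
Proof. by rewrite mulr_sumr; apply: eq_bigr => i _; rewrite !mxE mulrCA. Qed.

Lemma coord_le_enorm x i : `|x ord0 i| <= enorm x.
Proof.
rewrite -sqrtr_sqr; apply: ler_wsqrtr; rewrite (bigD1 i)//= lerDl.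
by apply: sumr_ge0 => j _; exact: sqr_ge0.
Qed.

Lemma enorm_eq0 x : enorm x = 0 -> x = 0.
Proof.
move=> x0; apply/rowP => i; rewrite mxE; apply/eqP.
by rewrite -normr_le0 -x0 coord_le_enorm.
Qed.

(** Cauchy-Schwarz, by expanding the square of the norm of [|y| x - |x| y]. *)
Lemma edot_le x y : edot x y <= enorm x * enorm y.
Proof.
have [x0|x0] := eqVneq (enorm x) 0.
  rewrite (enorm_eq0 x0) enorm0 mul0r /edot big1// => i _.
  by rewrite mxE mul0r.
have [y0|y0] := eqVneq (enorm y) 0.
  rewrite (enorm_eq0 y0) enorm0 mulr0 /edot big1// => i _.
  by rewrite mxE mulr0.
have xy0 : 0 < enorm x * enorm y by rewrite mulr_gt0// lt0r ?x0 ?y0 enorm_ge0.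
have := sqr_ge0 (enorm (enorm y *: x - enorm x *: y)).
rewrite sqr_enorm edotBr edotC (edotC _ (_ *: y)) !edotBr !edotZr.
rewrite ![edot (_ *: _) _]edotC !edotZr -!sqr_enorm (edotC y x) => h.
rewrite -(ler_pM2l xy0); move: h.
set p := edot x y; set a := enorm x; set b := enorm y => h; nra.
Qed.

Lemma ler_enormD x y : enorm (x + y) <= enorm x + enorm y.
Proof.
have xy0 : 0 <= enorm x + enorm y by rewrite addr_ge0 ?enorm_ge0.
rewrite -(@ler_pXn2r _ 2)// ?nnegrE ?enorm_ge0//.
rewrite sqr_enorm edotDr ![edot (x + y) _]edotC !edotDr sqrrD -!sqr_enorm.
have := edot_le x y; rewrite (edotC y x); lra.
Qed.

Lemma ler_enorm_sub x y z : enorm (x - z) <= enorm (x - y) + enorm (y - z).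
Proof. by rewrite (le_trans _ (ler_enormD _ _))// addrA subrK. Qed.

Lemma ler_enorm_dist x y : `|enorm x - enorm y| <= enorm (x - y).
Proof.
rewrite ler_norml; apply/andP; split.
  have := ler_enorm_sub y x 0; rewrite !subr0 (enorm_distC y x); lra.
by have := ler_enorm_sub x y 0; rewrite !subr0; lra.
Qed.

(** This comparison and [norm_le_enorm] transfer limits between the Euclidean
    norm and the sup norm, which defines the topology of the row vectors. *)
Lemma enorm_le_norm x : enorm x <= n%:R * `|x|.
Proof.
have h0 : 0 <= n%:R * `|x| by rewrite mulr_ge0.
rewrite -(@ler_pXn2r _ 2)// ?nnegrE ?enorm_ge0// sqr_enorm.
have h i : x ord0 i * x ord0 i <= `|x| ^+ 2.
  have xi : `|x ord0 i| <= `|x|.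
    by rewrite /Num.norm/= mx_normrE; exact: (le_bigmax _ _ (ord0, i)).
  rewrite -expr2 -real_normK ?num_real//; apply: lerXn2r => //.
  by rewrite nnegrE.
rewrite (le_trans (ler_sum _ (fun i _ => h i)))// sumr_const card_ord.
rewrite exprMn -[leLHS]mulr_natl ler_wpM2r ?sqr_ge0//.
by rewrite expr2 -natrM ler_nat; case: (n) => // m; rewrite leq_pmulr.
Qed.

Lemma norm_le_enorm x : `|x| <= enorm x.
Proof.
rewrite {1}/Num.norm/= mx_normrE; apply/bigmax_leP; split => [|[i j] _ /=].
  exact: enorm_ge0.
by rewrite (ord1 i); exact: coord_le_enorm.
Qed.

End enorm_theory.

(** * One-dimensional Hausdorff measure as a metric outer measure *)

Section hausdorff_theory.
Context {R : realType} {n : nat}.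
Implicit Types (A B U : set 'rV[R]_n) (d : R).
Local Open Scope ereal_scope.

Lemma ediam_ge0 A : 0 <= ediam A.
Proof. by rewrite /ediam le_max lexx. Qed.

Lemma ediam_set0 : ediam (set0 : set 'rV[R]_n) = 0.
Proof.
rewrite /ediam (_ : image2 _ _ _ = set0) ?ereal_sup0 ?maxEge ?leNye//.
by apply/seteqP; split => // z [].
Qed.

Lemma ediam_ub A (x y : 'rV[R]_n) : A x -> A y -> (enorm (x - y))%:E <= ediam A.
Proof.
move=> Ax Ay; rewrite /ediam le_max; apply/orP; right.
by apply: ereal_sup_ubound; exists x => //; exists y.
Qed.

Lemma ediam_le A (c : R) : (0 <= c)%R ->
  (forall x y, A x -> A y -> (enorm (x - y) <= c)%R) -> ediam A <= c%:E.
Proof.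
move=> c0 h; rewrite /ediam ge_max lee_fin c0/=.
by apply: ge_ereal_sup => _ [x Ax [y Ay <-]]; rewrite lee_fin h.
Qed.

Lemma le_ediam A B : A `<=` B -> ediam A <= ediam B.
Proof.
move=> AB; rewrite /ediam ge_max le_max lexx/=.
by apply: ge_ereal_sup => _ [x Ax [y Ay <-]]; apply: ediam_ub; exact: AB.
Qed.

(** The premeasure at scale [d] is the outer measure generated by this gauge,
    which gives its countable subadditivity. *)
Definition gauge d U : \bar R := if ediam U <= d%:E then ediam U else +oo.

Let T := g_sigma_algebraType [set: set 'rV[R]_n].

Lemma hausdorff1_preE d A :
  hausdorff1_pre d A = @mu_ext _ T R (gauge d) A.
Proof.
have mT (B : set T) : measurable B by exact: sub_gen_smallest.
apply/eqP; rewrite eq_le; apply/andP; split.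
  apply: le_ereal_inf_tmp => _ [U [mU AU] <-].
  have [[k Uk]|] := pselect (exists k, ~~ (ediam (U k) <= d%:E)).
    rewrite (@eseries_pinfty _ (gauge d \o U) xpredT k) ?leey//=.
      move=> i _; rewrite /gauge/=; case: ifP => // _.
      by rewrite gt_eqF// (lt_le_trans _ (ediam_ge0 _)).
    by rewrite /gauge (negbTE Uk).
  move=> /forallNP Ud.
  apply: ereal_inf_lbound; exists U => /=.
    by split=> // k; have /negP/negPn := Ud k.
  by apply: eq_eseriesr => k _; rewrite /gauge; have /negP/negPn -> := Ud k.
apply: le_ereal_inf_tmp => _ [U [AU Ud] <-].
apply: ereal_inf_lbound; exists U; first by split.
by apply: eq_eseriesr => k _; rewrite /gauge Ud.
Qed.

Lemma gauge_ge0 d U : 0 <= gauge d U.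
Proof. by rewrite /gauge; case: ifP => _; [exact: ediam_ge0|exact: leey]. Qed.

Lemma gauge0 d : (0 < d)%R -> gauge d set0 = 0.
Proof. by move=> d0; rewrite /gauge ediam_set0 lee_fin ltW. Qed.

Lemma hausdorff1_pre_ge0 d A : 0 <= hausdorff1_pre d A.
Proof. by rewrite hausdorff1_preE mu_ext_ge0//; exact: gauge_ge0. Qed.

Lemma le_hausdorff1_pre d : {homo @hausdorff1_pre R n d : A B / A `<=` B >-> A <= B}.
Proof. by move=> A B AB; rewrite !hausdorff1_preE; exact: le_mu_ext. Qed.

Lemma hausdorff1_pre_nonincreasing d d' A : (d <= d')%R ->
  hausdorff1_pre d' A <= hausdorff1_pre d A.
Proof.
move=> dd'; apply: ereal_inf_le_tmp => _ [U [AU Ud] <-].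
by exists U => //; split => // k; rewrite (le_trans (Ud k))// lee_fin.
Qed.

Lemma hausdorff1_pre_le d A : (0 < d)%R -> hausdorff1_pre d A <= hausdorff1 A.
Proof. by move=> d0; apply: ereal_sup_ubound; exists d. Qed.

Lemma hausdorff1_le A (x : \bar R) :
  (forall d, (0 < d)%R -> hausdorff1_pre d A <= x) -> hausdorff1 A <= x.
Proof. by move=> h; apply: ge_ereal_sup => _ [d /= d0 <-]; exact: h. Qed.

Lemma hausdorff1_ge0 A : 0 <= hausdorff1 A.
Proof.
by rewrite (le_trans (hausdorff1_pre_ge0 1 A))// hausdorff1_pre_le.
Qed.

Lemma le_hausdorff1 : {homo (@hausdorff1 R n) : A B / A `<=` B >-> A <= B}.
Proof.
move=> A B AB; apply: hausdorff1_le => d d0.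
by rewrite (le_trans (le_hausdorff1_pre d AB))// hausdorff1_pre_le.
Qed.

Lemma hausdorff1_pre_sigma_subadditive d (A : nat -> set 'rV[R]_n) :
  hausdorff1_pre d (\bigcup_k A k) <= \sum_(k <oo) hausdorff1_pre d (A k).
Proof.
rewrite hausdorff1_preE (le_trans (mu_ext_sigma_subadditive _ _))//.
  exact: gauge_ge0.
by under eq_eseriesr do rewrite -hausdorff1_preE.
Qed.

Lemma hausdorff1_sigma_subadditive (A : nat -> set 'rV[R]_n) :
  hausdorff1 (\bigcup_k A k) <= \sum_(k <oo) hausdorff1 (A k).
Proof.
apply: hausdorff1_le => d d0.
apply: le_trans (hausdorff1_pre_sigma_subadditive _ _) _.
apply: lee_nneseries => k _; first by move=> *; apply: hausdorff1_pre_ge0.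
exact: hausdorff1_pre_le.
Qed.

Lemma hausdorff1_pre_set0 d : (0 < d)%R ->
  hausdorff1_pre d (set0 : set 'rV[R]_n) = 0.
Proof.
by move=> d0; rewrite hausdorff1_preE mu_ext0//; [exact: gauge0|exact: gauge_ge0].
Qed.

Lemma hausdorff1_preU d A B : (0 < d)%R ->
  hausdorff1_pre d (A `|` B) <= hausdorff1_pre d A + hausdorff1_pre d B.
Proof.
move=> d0.
rewrite -bigcup2E (le_trans (hausdorff1_pre_sigma_subadditive _ _))//.
rewrite (nneseries_split 0%N 2%N); last by move=> k _; exact: hausdorff1_pre_ge0.
rewrite add0n eseries0 ?adde0; last first.
  by move=> [|[|k]]// _ _ /=; rewrite /bigcup2/= hausdorff1_pre_set0.
by rewrite !big_nat_recr//= big_nil add0e.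
Qed.

Lemma hausdorff1_set0 : hausdorff1 (set0 : set 'rV[R]_n) = 0.
Proof.
apply/eqP; rewrite eq_le hausdorff1_ge0 andbT; apply: hausdorff1_le => d d0.
by rewrite hausdorff1_pre_set0.
Qed.

Lemma hausdorff1U A B : hausdorff1 (A `|` B) <= hausdorff1 A + hausdorff1 B.
Proof.
apply: hausdorff1_le => d d0; rewrite (le_trans (hausdorff1_preU _ _ d0))//.
by rewrite leeD// hausdorff1_pre_le.
Qed.

Lemma hausdorff1_pre_le_ediam d A : (0 < d)%R -> ediam A <= d%:E ->
  hausdorff1_pre d A <= ediam A.
Proof.
move=> d0 Ad; apply: ereal_inf_lbound; exists (bigcup2 A set0).
  split; first by rewrite bigcup2E setU0.
  by move=> [|[|k]]//=; rewrite /bigcup2/= ediam_set0 lee_fin ltW.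
rewrite (nneseries_split 0%N 1%N); last by move=> k _; exact: ediam_ge0.
rewrite add0n eseries0 ?adde0; last first.
  by move=> [|[|k]]// _ _ /=; rewrite /bigcup2/= ediam_set0.
by rewrite !big_nat_recr//= big_nil add0e.
Qed.

(** A cover by sets of diameter less than the gap between [A] and [B] splits
    into a cover of [A] and a cover of [B]. *)
Lemma hausdorff1_separated A B (r : R) : (0 < r)%R ->
  (forall x y, A x -> B y -> (r <= enorm (x - y))%R) ->
  hausdorff1 A + hausdorff1 B <= hausdorff1 (A `|` B).
Proof.
move=> r0 AB.
have key d : (0 < d)%R -> (d < r)%R ->
    hausdorff1_pre d A + hausdorff1_pre d B <= hausdorff1 (A `|` B).
  move=> d0 dr; rewrite (le_trans _ (hausdorff1_pre_le _ d0))//.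
  apply: le_ereal_inf_tmp => _ [U [ABU Ud] <-].
  apply: (@le_trans _ _ (\sum_(k <oo) ediam (U k `&` A) +
                         \sum_(k <oo) ediam (U k `&` B))).
    apply: leeD; apply: ereal_inf_lbound => /=.
      exists (fun k => U k `&` A) => //; split => [x Ax|k].
        by have [k _ Ukx] := ABU x (or_introl Ax); exists k.
      by rewrite (le_trans _ (Ud k))// le_ediam//; exact: subIsetl.
    exists (fun k => U k `&` B) => //; split => [x Bx|k].
      by have [k _ Ukx] := ABU x (or_intror Bx); exists k.
    by rewrite (le_trans _ (Ud k))// le_ediam//; exact: subIsetl.
  rewrite -nneseriesD; try by move=> *; exact: ediam_ge0.
  apply: lee_nneseries => k _; first by rewrite adde_ge0// ediam_ge0.
  have [->|/set0P[x [Ux Ax]]] := eqVneq (U k `&` A) set0.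
    by rewrite ediam_set0 add0e le_ediam//; exact: subIsetl.
  have [->|/set0P[y [Uy By]]] := eqVneq (U k `&` B) set0.
    by rewrite ediam_set0 adde0 le_ediam//; exact: subIsetl.
  have := le_trans (ediam_ub Ux Uy) (Ud k); rewrite lee_fin => xyd.
  by have := lt_le_trans dr (le_trans (AB x y Ax By) xyd); rewrite ltxx.
have {}key d d' : (0 < d)%R -> (0 < d')%R ->
    hausdorff1_pre d A + hausdorff1_pre d' B <= hausdorff1 (A `|` B).
  move=> d0 d'0; pose e := Num.min (r / 2)%R (Num.min d d').
  have e0 : (0 < e)%R by rewrite !lt_min d0 d'0 divr_gt0.
  have er : (e < r)%R by rewrite gt_min; apply/orP; left; lra.
  rewrite (le_trans _ (key e e0 er))//.
  by apply: leeD; apply: hausdorff1_pre_nonincreasing;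
    rewrite !ge_min lexx ?orbT.
have [->|ABoo] := eqVneq (hausdorff1 (A `|` B)) +oo; first exact: leey.
have fin (x : \bar R) : 0 <= x -> x <= hausdorff1 (A `|` B) -> x \is a fin_num.
  by move=> x0 xAB; rewrite ge0_fin_numE// (le_lt_trans xAB)// ltey.
have finA : hausdorff1 A \is a fin_num.
  by rewrite fin ?hausdorff1_ge0// le_hausdorff1//; exact: subsetUl.
rewrite addeC -leeBrDr//; apply: hausdorff1_le => d d0.
rewrite leeBrDr// addeC -leeBrDr//; last first.
  rewrite fin ?hausdorff1_pre_ge0//.
  by rewrite (le_trans (hausdorff1_pre_le _ d0))// le_hausdorff1//; exact: subsetUr.
apply: hausdorff1_le => d' d'0; rewrite leeBrDr//; first exact: key.
rewrite fin ?hausdorff1_pre_ge0//.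
by rewrite (le_trans (hausdorff1_pre_le _ d0))// le_hausdorff1//; exact: subsetUr.
Qed.

End hausdorff_theory.

(** * Continuity from above at a closed set *)

Section hausdorff_nbhd.
Context {R : realType} {n : nat}.
Implicit Types (A K : set 'rV[R]_n) (r : R).
Local Open Scope ereal_scope.

Definition enbhd K r : set 'rV[R]_n :=
  [set z | exists2 x, K x & (enorm (z - x) < r)%R].

Lemma le_enbhd K r r' : (r <= r')%R -> enbhd K r `<=` enbhd K r'.
Proof. by move=> rr' z [x Kx zx]; exists x => //; exact: lt_le_trans rr'. Qed.

Lemma hausdorff1_sum_separated A (X : nat -> set 'rV[R]_n) :
  (forall m, exists2 r : R, (0 < r)%R & forall i x y, (i < m)%N ->
    X i x -> X m y -> (r <= enorm (x - y))%R) ->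
  (forall m, X m `<=` A) ->
  forall m, \sum_(i < m) hausdorff1 (X i) <= hausdorff1 A.
Proof.
move=> sep XA m.
apply: (@le_trans _ _ (hausdorff1 (\big[setU/set0]_(i < m) X i))); last first.
  by apply: le_hausdorff1; elim/big_ind: _ => // B C BA CA; rewrite subUset.
elim: m => [|m ih]; first by rewrite !big_ord0 hausdorff1_ge0.
rewrite !big_ord_recr/= (le_trans (leeD2r _ ih))//.
have [r r0 rX] := sep m; apply: (hausdorff1_separated r0) => x y.
by rewrite -bigcup_mkord => -[i /= im Xix] Xmy; exact: (rX i).
Qed.

Let shell A K (k : nat) := A `&` (enbhd K k.+1%:R^-1 `\` enbhd K k.+2%:R^-1).

Lemma shell_separated A K o m : exists2 r : R, (0 < r)%R &
  forall i x y, (i < m)%N -> shell A K (i.*2 + o) x -> shell A K (m.*2 + o) y ->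
    (r <= enorm (x - y))%R.
Proof.
case: m => [|m]; first by exists 1%R.
set p := (m.+1.*2 + o)%N.
exists (p%:R^-1 - p.+1%:R^-1)%R.
  by rewrite subr_gt0 ltf_pV2 ?posrE ?ltr0n ?ltr_nat.
move=> i x y im [_ [_ xK]] [_ [[z Kz yz] _]].
rewrite leNgt; apply/negP => xy; apply: xK.
apply: (@le_enbhd _ p%:R^-1).
  rewrite lef_pV2 ?posrE ?ltr0n// ler_nat -!addSn leq_add2r.
  by rewrite doubleS !ltnS leq_double -ltnS.
exists z => //; apply: (le_lt_trans (ler_enorm_sub _ y _)).
by rewrite -(subrK p.+1%:R^-1%R p%:R^-1%R) ltrD.
Qed.

(** Continuity from above at a closed set [K], for an arbitrary set [A] of
    finite measure. Cut [A] into shells by the distance to [K]. Shells whose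
    indices differ by at least two are at positive distance, so the measures of
    the even shells, and of the odd ones, have a sum bounded by that of [A]; the
    tails of the series over all shells then vanish. *)
Lemma hausdorff1_enbhd A K (e : R) : hausdorff1 A < +oo -> (0 < e)%R ->
  (forall z, (forall r, (0 < r)%R -> enbhd K r z) -> K z) ->
  exists2 r : R, (0 < r)%R &
    hausdorff1 (A `&` enbhd K r) <= hausdorff1 (A `&` K) + e%:E.
Proof.
move=> Aoo e0 clK.
have sum_le o m : \sum_(i < m) hausdorff1 (shell A K (i.*2 + o)) <= hausdorff1 A.
  apply: (@hausdorff1_sum_separated A (fun i => shell A K (i.*2 + o))).
    by move=> k; exact: shell_separated.
  by move=> k x [].
have fin : \sum_(k <oo) hausdorff1 (shell A K k) < +oo.
  apply: (@le_lt_trans _ _ (hausdorff1 A + hausdorff1 A)); last exact: lte_add_pinfty.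
  apply: lime_le; first by apply: is_cvg_nneseries => k _ _; exact: hausdorff1_ge0.
  apply: nearW => m.
  apply: (@le_trans _ _ (\sum_(i < m.*2) hausdorff1 (shell A K i))).
    rewrite big_mkord.
    apply: (@lee_sum_nneg_ord _ (fun k => hausdorff1 (shell A K k)) xpredT).
      by move=> k _; exact: hausdorff1_ge0.
    by rewrite -addnn leq_addr.
  apply: le_trans (leeD (sum_le 0%N m) (sum_le 1%N m)).
  rewrite -big_split/=; elim: m => [|m ih]; first by rewrite !big_ord0.
  rewrite doubleS !big_ord_recr/= -addeA; apply: leeD => //.
  by rewrite addn0 addn1.
have : \forall N \near \oo, \sum_(N <= k <oo) hausdorff1 (shell A K k) < e%:E.
  have tail0 := nneseries_tail_cvg fin (fun k _ => hausdorff1_ge0 (shell A K k)).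
  exact: tail0 _ (@nbhs_open_ereal_lt _ 0%R (fun=> e) e0).
move=> [N _ /(_ N (leqnn N))/= tail].
exists N.+1%:R^-1%R; first by rewrite invr_gt0.
apply: (@le_trans _ _ (hausdorff1 (A `&` K `|`
    \bigcup_k shell A K (k + N)))).
  apply: le_hausdorff1 => z [Az Nz].
  have [Kz|nKz] := pselect (K z); [by left|right].
  have ex : exists k, ~~ `[< enbhd K k.+1%:R^-1 z >].
    apply: contra_notP nKz => /forallNP h; apply: clK => r r0.
    have [k kr] := ltr_add_invr r0; rewrite add0r in kr.
    by apply: le_enbhd (ltW kr) _ _; have /negP/negPn/asboolP := h k.
  case: (ex_minnP ex) => k /asboolPn nk kmin.
  have Nk : (N < k)%N.
    rewrite ltnNge; apply/negP => kN; apply: nk; apply: le_enbhd Nz.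
    by rewrite lef_pV2 ?posrE ?ltr0n// ler_nat ltnS.
  case: k Nk nk kmin {ex} => // k; rewrite ltnS => Nk nk kmin.
  exists (k - N)%N => //; rewrite subnK//; split => //; split => //.
  have := contraNN (kmin k); rewrite ltnn => /(_ isT).
  by rewrite negbK => /asboolP.
rewrite (le_trans (hausdorff1U _ _))// leeD2l//.
rewrite (le_trans (hausdorff1_sigma_subadditive _))//.
rewrite (le_trans _ (ltW tail))//.
rewrite (@nneseries_addn _ (fun k => hausdorff1 (shell A K k)) N)// => k.
exact: hausdorff1_ge0.
Qed.

End hausdorff_nbhd.

(** * Hausdorff measure of Lipschitz images and of arcs *)

Section lipschitz_image.
Context {R : realType} {n : nat}.
Notation mu := (@lebesgue_measure R).
Implicit Types (E : set R) (K s t : R).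
Local Open Scope ereal_scope.

Variables (f : R -> 'rV[R]_n) (K : R).
Hypothesis K0 : (0 <= K)%R.
Hypothesis fK : forall s t, (enorm (f s - f t) <= K * `|s - t|)%R.

Lemma ediam_lipschitz_itv (a b : R) : (a <= b)%R ->
  ediam (f @` `[a, b]) <= (K * (b - a))%:E.
Proof.
move=> ab; apply: ediam_le; first by rewrite mulr_ge0// subr_ge0.
move=> _ _ [s /= + <-] [t /= + <-]; rewrite !in_itv/= => /andP[sa sb] /andP[ta tb].
by rewrite (le_trans (fK _ _))// ler_wpM2l// ler_norml; apply/andP; split; lra.
Qed.

(** At scale [d], cut [[a, b]] into pieces of length at most [h], so that the
    images of the pieces have diameter at most [d]. *)
Lemma hausdorff1_lipschitz_itv (a b : R) : (a <= b)%R ->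
  hausdorff1 (f @` `[a, b]) <= (K * (b - a))%:E.
Proof.
move=> ab; apply: hausdorff1_le => d d0.
(* [K + 1] rather than [K] also covers [K = 0] *)
pose h := (d / (K + 1))%R.
have K1 : (0 < K + 1)%R by rewrite ltr_wpDl.
have h0 : (0 < h)%R by rewrite divr_gt0.
have Kh : (K * h <= d)%R.
  by rewrite /h mulrA ler_pdivrMr// mulrC ler_wpM2l ?(ltW d0)// lerDl.
have key (m : nat) (c : R) : (a <= c)%R -> (c <= a + m%:R * h)%R ->
    hausdorff1_pre d (f @` `[a, c]) <= (K * (c - a))%:E.
  elim: m c => [|m ih] c ac cm.
    have -> : c = a by apply/eqP; rewrite eq_le ac andbT; move: cm; rewrite mul0r addr0.
    apply: le_trans (ediam_lipschitz_itv (lexx a)).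
    apply: (hausdorff1_pre_le_ediam d0).
    by rewrite (le_trans (ediam_lipschitz_itv (lexx a)))// subrr mulr0 lee_fin ltW.
  have [cm'|mc] := leP c (a + m%:R * h)%R; first exact: ih.
  set c' := (a + m%:R * h)%R in ih mc.
  have ac' : (a <= c')%R by rewrite lerDl mulr_ge0// ltW.
  have cc' : (c - c' <= h)%R by move: cm; rewrite /c' -natr1 mulrDl mul1r; lra.
  have -> : f @` `[a, c] = f @` `[a, c'] `|` f @` `[c', c].
    rewrite -image_setU; congr image; apply/seteqP; split => x /=; rewrite !in_itv/=.
      move=> /andP[ax xc]; have [xc'|xc'] := leP x c'; [left|right];
        apply/andP; split => //; exact: ltW.
    by move=> [|] /andP[? ?]; apply/andP; split => //; lra.
  rewrite (le_trans (hausdorff1_preU _ _ d0))//.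
  have -> : ((K * (c - a))%:E = (K * (c' - a))%:E + (K * (c - c'))%:E).
    by rewrite -EFinD; congr EFin; ring.
  apply: leeD; first exact: ih.
  apply: le_trans (ediam_lipschitz_itv (ltW mc)).
  apply: (hausdorff1_pre_le_ediam d0).
  rewrite (le_trans (ediam_lipschitz_itv (ltW mc)))// lee_fin.
  by rewrite (le_trans _ Kh)// ler_wpM2l.
apply: (key (Num.bound ((b - a) / h))) => //.
rewrite -lerBlDl -ler_pdivrMr//; apply/ltW/archi_boundP.
by rewrite divr_ge0 ?(ltW h0)// subr_ge0.
Qed.

(** A cover of [E] by intervals is mapped to a cover of the image by arcs, of
    measure at most [K] times the lengths of the intervals. *)
Lemma hausdorff1_lipschitz_image E : hausdorff1 (f @` E) <= K%:E * mu E.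
Proof.
move: K0; rewrite le_eqVlt => /predU1P[K00|Kgt0].
  rewrite -K00 mul0e.
  apply: (@le_trans _ _ (hausdorff1 (f @` `[0%R, 0%R]))).
    apply: le_hausdorff1 => _ [t _ <-]; exists 0%R; first by rewrite /= in_itv/= lexx.
    apply/eqP; rewrite -subr_eq0; apply/eqP/enorm_eq0/eqP.
    by rewrite eq_le enorm_ge0 andbT (le_trans (fK _ _))// -K00 mul0r.
  by rewrite (le_trans (hausdorff1_lipschitz_itv (lexx _)))// subrr mulr0.
rewrite muleC -lee_pdivrMr//.
apply: le_ereal_inf_tmp => _ [A [mA EA] <-].
rewrite lee_pdivrMr// muleC -nneseriesZl//.
apply: (@le_trans _ _ (hausdorff1 (\bigcup_k f @` A k))).
  by apply: le_hausdorff1; rewrite -image_bigcup; exact: image_subset.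
rewrite (le_trans (hausdorff1_sigma_subadditive _))//.
apply: lee_nneseries => k _; first by move=> *; exact: hausdorff1_ge0.
have /ocitvP[->|[[x y]/= xy ->]] := mA k.
  by rewrite image_set0 hausdorff1_set0 measure0 mule0.
rewrite wlength_itv_bnd/= -?EFinM; last exact: ltW.
apply: (le_trans _ (hausdorff1_lipschitz_itv (ltW xy))).
apply/le_hausdorff1/image_subset; exact: subset_itv_oc_cc.
Qed.

Lemma lipschitz_continuous : continuous f.
Proof.
move=> t; apply/cvgrPdist_lt => e e0.
have K1 : (0 < K + 1)%R by rewrite ltr_wpDl.
apply/nbhs_ballP; exists (e / (K + 1))%R; first exact: divr_gt0.
move=> s; rewrite /ball/= ltr_pdivlMr// => ts.
rewrite (le_lt_trans (norm_le_enorm _))// (le_lt_trans (fK _ _))//.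
by rewrite (le_lt_trans _ ts)// mulrC ler_wpM2l// lerDl.
Qed.

Lemma continuous_enorm_sub (z : 'rV[R]_n) : continuous (fun t => enorm (f t - z)).
Proof.
move=> t; apply/cvgrPdist_lt => e e0.
have K1 : (0 < K + 1)%R by rewrite ltr_wpDl.
apply/nbhs_ballP; exists (e / (K + 1))%R; first exact: divr_gt0.
move=> s; rewrite /ball/= ltr_pdivlMr// => ts.
rewrite (le_lt_trans (ler_enorm_dist _ _))// opprB addrA subrK.
rewrite (le_lt_trans (fK _ _))//.
by rewrite (le_lt_trans _ ts)// mulrC ler_wpM2l// lerDl.
Qed.

(** The map [z |-> |z - f s|] does not increase diameters, and by the
    intermediate value theorem it sends the arc onto a set that contains
    [[0, |f t - f s|]]. *)
Lemma le_hausdorff1_arc s t : (s <= t)%R ->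
  (enorm (f t - f s))%:E <= hausdorff1 (f @` `[s, t]).
Proof.
move=> st; set v := enorm _.
apply: le_trans (hausdorff1_pre_le _ ltr01).
apply: le_ereal_inf_tmp => _ [U [AU Ud] <-].
pose phi (z : 'rV[R]_n) := enorm (z - f s).
have cov : `[0%R, v] `<=` \bigcup_k (phi @` U k).
  move=> y /=; rewrite in_itv/= => yv.
  have [||c cst cy] := @IVT _ (phi \o f) s t y st.
  - by apply: continuous_subspaceT; exact: continuous_enorm_sub.
  - rewrite /= /phi subrr enorm0 -/v minEle maxEle.
    by have [|] := leP 0%R v => //; rewrite ltNge enorm_ge0.
  have [|k _ Uk] := AU (f c); first by exists c.
  by exists k => //; exists (f c).
have -> : v%:E = mu `[0%R, v].
  rewrite lebesgue_measure_itv/= lte_fin.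
  have [v0|v0] := ltP 0%R v; first by rewrite sube0.
  by congr EFin; apply/eqP; rewrite eq_le v0 enorm_ge0.
apply: (@le_trans _ _ (mu (\bigcup_k (phi @` U k)))); first exact: le_mu_ext.
apply: (le_trans (mu_ext_sigma_subadditive _ _)); first exact: measure_ge0.
apply: lee_nneseries => k _; first by move=> *; rewrite mu_ext_ge0//; exact: measure_ge0.
have [->|/set0P[z0 Uz0]] := eqVneq (U k) set0.
  by rewrite image_set0 ediam_set0 mu_ext0//; exact: measure_ge0.
have : ediam (U k) \is a fin_num.
  by rewrite ge0_fin_numE ?ediam_ge0// (le_lt_trans (Ud k))// ltey.
move=> /fineK; set D := fine _ => DE.
have phiD z z' : U k z -> U k z' -> (phi z <= phi z' + D)%R.
  move=> Uz Uz'; rewrite -lerBlDl (le_trans (ler_norm _))//.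
  rewrite (le_trans (ler_enorm_dist _ _))// opprB addrA subrK.
  by rewrite -lee_fin DE ediam_ub.
set B := phi @` U k.
have B0 : B !=set0 by exists (phi z0), z0.
have hsB : has_sup B.
  by split => //; exists (phi z0 + D)%R => _ [z Uz <-]; exact: phiD.
have hiB : has_inf B.
  by split => //; exists (phi z0 - D)%R => _ [z Uz <-]; rewrite lerBlDr; exact: phiD.
apply: (@le_trans _ _ (mu `[inf B, sup B])).
  apply: le_mu_ext => y By /=; rewrite in_itv/=; apply/andP; split.
    by apply: inf_lbound => //; case: hiB.
  by apply: sup_upper_bound.
rewrite lebesgue_measure_itv/= lte_fin; case: ifPn => _; last exact: ediam_ge0.
rewrite -DE -EFinB lee_fin lerBlDr -lerBlDl.
apply: lb_le_inf => // _ [z Uz <-].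
rewrite lerBlDl; apply: ge_sup => // _ [z' Uz' <-].
by rewrite addrC; exact: phiD.
Qed.

End lipschitz_image.

(** * Displacement against time spent outside a set of finite measure *)

Section uncovered_arc.
Context {R : realType} {n : nat}.
Notation mu := (@lebesgue_measure R).
Local Open Scope ereal_scope.

(** By compactness, the distance from [z] to the arc is attained. *)
Lemma arc_closed (f : R -> 'rV[R]_n) (K s t : R) (z : 'rV[R]_n) : (0 <= K)%R ->
  (forall x y, (enorm (f x - f y) <= K * `|x - y|)%R) -> (s <= t)%R ->
  (forall r : R, (0 < r)%R -> enbhd (f @` `[s, t]) r z) -> (f @` `[s, t]) z.
Proof.
move=> K0 fK st zK.
have [|c cst cmin] := @EVT_min R (fun x => enorm (f x - z)) s t st.
  by apply: continuous_subspaceT; exact: (continuous_enorm_sub K0 fK).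
exists c => //; apply/eqP; rewrite -subr_eq0; apply/eqP/enorm_eq0/eqP.
rewrite eq_le enorm_ge0 andbT leNgt; apply/negP => c0.
have [_ [x xst <-]] := zK _ c0.
by rewrite enorm_distC ltNge cmin.
Qed.

(** The displacement of [g] is bounded by the measure of the arc of [gs j], up
    to an error. Of that arc, the part outside [A] has measure at most
    [c j] times the time spent there, and the part in [A] lies in a small
    neighbourhood of the arc of [g], hence has measure at most that of
    [A] on the arc of [g], up to an error. *)
Lemma near_displacement_le (A : set 'rV[R]_n) (gs : nat -> R -> 'rV[R]_n)
    (g : R -> 'rV[R]_n) (c : nat -> R) (C s t e : R) :
  hausdorff1 A < +oo ->
  (forall j, (0 <= c j)%R) -> (0 <= C)%R ->
  (forall j x y, (enorm (gs j x - gs j y) <= c j * `|x - y|)%R) ->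
  (forall x y, (enorm (g x - g y) <= C * `|x - y|)%R) ->
  (forall r : R, (0 < r)%R ->
    \forall j \near \oo, forall x, (enorm (gs j x - g x) < r)%R) ->
  (s <= t)%R -> (0 < e)%R ->
  \forall j \near \oo, (enorm (g t - g s))%:E <=
    (c j)%:E * mu (`[s, t] `\` gs j @^-1` A) +
    C%:E * mu (`[s, t] `&` g @^-1` A) + e%:E.
Proof.
move=> Aoo c0 C0 gsc gC gsg st e0.
have e4 : (0 < e / 4)%R by rewrite divr_gt0.
have e2 : (0 < e / 2)%R by rewrite divr_gt0.
have [r r0 Ar] := hausdorff1_enbhd Aoo e2 (fun z => arc_closed C0 gC st (z := z)).
have := gsg (Num.min r (e / 4))%R; rewrite lt_min r0 e4 => /(_ isT).
apply: filterS => j gsj.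
have gsjr x : (enorm (gs j x - g x) < r)%R by have := gsj x; rewrite lt_min => /andP[].
have gsje x : (enorm (gs j x - g x) < e / 4)%R by have := gsj x; rewrite lt_min => /andP[].
apply: (@le_trans _ _ ((enorm (gs j t - gs j s))%:E + (e / 2)%:E)).
  rewrite -EFinD lee_fin (le_trans (ler_enorm_sub _ (gs j t) _))//.
  have := gsje t; have := gsje s; have := ler_enorm_sub (gs j t) (gs j s) (g s).
  rewrite (enorm_distC (g t)); lra.
rewrite {2}(splitr e) EFinD addeA; apply: leeD => //.
apply: (le_trans (le_hausdorff1_arc (c0 j) (gsc j) st)).
apply: (@le_trans _ _ (hausdorff1 (gs j @` (`[s, t] `\` gs j @^-1` A) `|`
    A `&` enbhd (g @` `[s, t]) r))).
  apply: le_hausdorff1 => _ [x xst <-].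
  have [Ax|Ax] := pselect (A (gs j x)); last by left; exists x.
  by right; split => //; exists (g x) => //; exists x.
rewrite (le_trans (hausdorff1U _ _))// -addeA; apply: leeD.
  exact: (hausdorff1_lipschitz_image (c0 j) (gsc j)).
rewrite (le_trans Ar)//; apply: leeD => //.
apply: le_trans (hausdorff1_lipschitz_image C0 gC _).
by apply: le_hausdorff1 => z [Az [x xst xz]]; exists x => //; split; rewrite /preimage/= ?xz.
Qed.

End uncovered_arc.

(** * Differentiability of Lipschitz functions almost everywhere *)

Section rademacher.
Context {R : realType}.
Notation mu := (@lebesgue_measure R).
Local Open Scope ereal_scope.

Lemma rlipschitz_continuous (f : R -> R) (K : R) : (0 <= K)%R ->
  (forall x y, (`|f x - f y| <= K * `|x - y|)%R) -> continuous f.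
Proof.
move=> K0 fK t; apply/cvgrPdist_lt => e e0.
have K1 : (0 < K + 1)%R by rewrite ltr_wpDl.
apply/nbhs_ballP; exists (e / (K + 1))%R; first exact: divr_gt0.
move=> s; rewrite /ball/= ltr_pdivlMr// => ts.
rewrite (le_lt_trans (fK _ _))//.
by rewrite (le_lt_trans _ ts)// mulrC ler_wpM2l// lerDl.
Qed.

(** Both measures are infima over the same covers by intervals [`]x, y]],
    whose weights compare. *)
Lemma stieltjes_lipschitz_le (F : cumulative R R) (M : R) : (0 < M)%R ->
  (forall x y, (x <= y)%R -> (F y - F x <= M * (y - x))%R) ->
  forall A, lebesgue_stieltjes_measure F A <= M%:E * mu A.
Proof.
move=> M0 FM A; rewrite muleC -lee_pdivrMr//.
apply: le_ereal_inf_tmp => _ [B [mB AB] <-].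
rewrite lee_pdivrMr// muleC -nneseriesZl//.
apply: (@le_trans _ _ (\sum_(k <oo) wlength F (B k))).
  by apply: ereal_inf_lbound; exists B.
apply: lee_nneseries => k _; first by move=> *; exact: wlength_ge0.
have /ocitvP[->|[[x y]/= xy ->]] := mB k; first by rewrite !measure0 mule0.
rewrite !wlength_itv_bnd/=; [|exact: ltW..].
by rewrite -EFinM lee_fin FM// ltW.
Qed.

Lemma stieltjes_oc (F : cumulative R R) (x y : R) : (x <= y)%R ->
  lebesgue_stieltjes_measure F `]x, y] = (F y - F x)%:E.
Proof.
move=> xy; rewrite /lebesgue_stieltjes_measure/= /measure_extension.
rewrite measurable_mu_extE; last exact: is_ocitv.
by move=> /=; rewrite wlength_itv_bnd.
Qed.

(** The nondecreasing function [f + K id] generates a Stieltjes measure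
    dominated by [2 K] times the Lebesgue measure; [w] is its density, and
    Lebesgue's differentiation theorem identifies [w - K] with the derivative
    of [f]. *)
Lemma lipschitz_density (f : R -> R) (K : R) : (0 < K)%R ->
  (forall x y, (`|f x - f y| <= K * `|x - y|)%R) ->
  exists w : R -> R, [/\ (forall x, (0 <= w x)%R),
    mu.-integrable setT (EFin \o w),
    (forall s t : R, (0 <= s)%R -> (s <= t)%R -> (t <= 1)%R ->
      \int[mu]_(x in `]s, t]) (w x)%:E = (f t - f s + K * (t - s))%:E) &
    {ae mu, forall t, (0 < t < 1)%R ->
      derivable f t 1 /\ (derive1 f t = w t - K)%R}].
Proof.
move=> K0 fK.
pose F0 x := (f x + K * x)%R.
have F0nd : nondecreasing F0.
  move=> x y xy; rewrite /F0.
  have := fK x y; rewrite distrC (distrC x) (ger0_norm (_ : (0 <= y - x)%R)) ?subr_ge0//.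
  rewrite ler_norml => /andP[]; lra.
have F0c : continuous F0.
  move=> x; apply: cvgD; first exact: (rlipschitz_continuous (ltW K0) fK).
  by apply: cvgM; [exact: cvg_cst|exact: cvg_id].
have F0rc : right_continuous F0 by exact: right_continuousW.
pose F : cumulative R R := HB.pack F0 (isCumulative.Build R _ R F0 F0nd F0rc).
have FM x y : (x <= y)%R -> (F y - F x <= (K + K) * (y - x))%R.
  move=> xy; rewrite /F/= /F0.
  have := fK x y; rewrite distrC (distrC x) (ger0_norm (_ : (0 <= y - x)%R)) ?subr_ge0//.
  rewrite ler_norml => /andP[]; lra.
pose D := `]0%R, 1%R]%classic : set (measurableTypeR R).
have mD : measurable D by exact: measurable_itv.
have KK0 : (0 < K + K)%R by rewrite addr_gt0.
have Doo : lebesgue_stieltjes_measure F D < +oo by rewrite stieltjes_oc// ltry.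
pose nu : {finite_measure set (measurableTypeR R) -> \bar R} := mfrestr mD Doo.
have numu : nu `<< mu.
  apply/null_content_dominatesP => A mA A0.
  apply/eqP; rewrite eq_le measure_ge0 andbT.
  have := stieltjes_lipschitz_le KK0 FM A; rewrite A0 mule0.
  by apply: le_trans; apply: le_measure; rewrite ?inE//; exact: measurableI.
have [w [w0 wfin wint nuE]] := radon_nikodym_sigma_finite numu.
have wE : EFin \o (fine \o w) = w by apply/funext => x /=; rewrite fineK.
have intE (s t : R) : (0 <= s)%R -> (s <= t)%R -> (t <= 1)%R ->
    \int[mu]_(x in `]s, t]) w x = (f t - f s + K * (t - s))%:E.
  move=> s0 st t1; rewrite -nuE; last exact: measurable_itv.
  rewrite /nu/= /mfrestr /mrestr setIidl.
    by rewrite stieltjes_oc//; congr EFin; rewrite /F/= /F0; ring.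
  by apply: subitvP; rewrite subitvE !bnd_simp s0 t1.
exists (fine \o w); split.
- by move=> x /=; rewrite fine_ge0.
- by rewrite wE.
- move=> s t s0 st t1; rewrite -intE//.
  by apply: eq_integral => x _ /=; rewrite fineK.
have wloc : locally_integrable [set: R] (fine \o w).
  by apply: open_integrable_locally; [exact: openT|rewrite wE].
have wy (y : R) : mu.-integrable [set` Interval (BRight 0%R) (BRight y)]
    (EFin \o (fine \o w)).
  by rewrite wE; apply: integrableS wint.
have := FTC1 wy wloc; set G := (fun x => _) => aeG.
apply: (@filterS _ _ (ae_filter_ringOfSetsType mu) _ _ _ aeG) => t /= aet /andP[t0 t1].
have [|dG GE] := aet; first by rewrite lte_fin.
have fE : {near t, (fun x => f 0 + (G x - K * x))%R =1 f}.
  near=> x.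
  have x01 : (0 < x < 1)%R.
    near: x; have : t \in `]0%R, 1%R[ by rewrite in_itv/= t0 t1.
    by move/near_in_itvoo; apply: filterS => x; rewrite in_itv.
  case/andP: x01 => x0 x1.
  have -> : G x = (f x - f 0 + K * (x - 0))%R.
    rewrite /G /Rintegral.
    have -> : \int[mu]_(z in `]0%R, x]) ((fine \o w) z)%:E =
        \int[mu]_(z in `]0%R, x]) w z.
      by apply: eq_integral => z _ /=; rewrite fineK.
    by rewrite intE ?(ltW x0) ?(ltW x1).
  by ring.
have dh : is_derive t 1%R (fun x => f 0 + (G x - K * x))%R (derive1 G t - K)%R.
  rewrite derive1E.
  have isG : is_derive t 1%R G ('D_1 G t) by exact: derivableP.
  by apply: is_derive_eq; rewrite add0r mul1r /GRing.scale/= mulr1.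
have [df fE'] := near_eq_is_derive fE dh.
by split => //; rewrite derive1E fE' GE.
Unshelve. all: by end_near. Qed.

(** The density of [h + K id] is nonnegative and at most [c + K] almost
    everywhere; integrate this bound. *)
Lemma growth_le (h : R -> R) (K c : R) : (0 < K)%R -> (0 <= c)%R ->
  (forall x y, (`|h x - h y| <= K * `|x - y|)%R) ->
  {ae mu, forall t, (0 < t < 1)%R -> (derive1 h t <= c)%R} ->
  forall s t : R, (0 <= s)%R -> (s <= t)%R -> (t <= 1)%R ->
    (h t - h s <= c * (t - s))%R.
Proof.
move=> K0 c0 hK hc s t s0 st t1.
have [w [w0 wint wE wd]] := lipschitz_density K0 hK.
suff : (h t - h s + K * (t - s))%:E <= ((c + K) * (t - s))%:E.
  by rewrite lee_fin mulrDl lerD2r.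
rewrite -wE//.
have -> : ((c + K) * (t - s))%:E = \int[mu]_(x in `]s, t[) (c + K)%:E.
  rewrite integral_cst//= lebesgue_measure_itv/= lte_fin.
  case: ltP => // ts; have -> : t = s by apply/eqP; rewrite eq_le st ts.
  by rewrite subrr mulr0 mule0.
have mw := measurable_int _ wint.
rewrite -integral_itv_bndo_bndc; last exact: measurable_funS mw.
apply: ae_ge0_le_integral => //=.
- by move=> x _; rewrite lee_fin w0.
- exact: measurable_funS mw.
- by move=> x _; rewrite lee_fin addr_ge0// ltW.
near=> x; rewrite /= in_itv/= => /andP[sx xt]; rewrite lee_fin -lerBlDr.
have x01 : (0 < x < 1)%R by apply/andP; split; lra.
have [_ <-] : derivable h x 1 /\ (derive1 h x = w x - K)%R by move: x01; near: x.
by move: x01; near: x.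
Unshelve. all: by end_near. Qed.

End rademacher.

(** * Constant speed as a Lipschitz constant *)

Section constant_speed_theory.
Context {R : realType} {n : nat}.
Notation mu := (@lebesgue_measure R).

Lemma coord_lipschitz (g : R -> 'rV[R]_n) (K : R) :
  (forall x y, enorm (g x - g y) <= K * `|x - y|) ->
  forall i x y, `|g x ord0 i - g y ord0 i| <= K * `|x - y|.
Proof.
move=> gK i x y; apply: le_trans (gK x y).
by have := coord_le_enorm (g x - g y) i; rewrite !mxE.
Qed.

Lemma edot_lipschitz (v : 'rV[R]_n) (g : R -> 'rV[R]_n) (K : R) :
  (forall x y, enorm (g x - g y) <= K * `|x - y|) ->
  forall x y, `|edot v (g x) - edot v (g y)| <= enorm v * K * `|x - y|.
Proof.
move=> gK x y; rewrite -edotBr ler_norml lerNl; apply/andP; split.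
  rewrite edotBr opprB -edotBr (le_trans (edot_le _ _))//.
  by rewrite -mulrA ler_wpM2l ?enorm_ge0// enorm_distC.
by rewrite (le_trans (edot_le _ _))// -mulrA ler_wpM2l ?enorm_ge0.
Qed.

(** The speed of a Lipschitz path, as a measurable function: off a null set it
    is computed from the densities of the coordinates. *)
Lemma lipschitz_speed (g : R -> 'rV[R]_n) (K : R) : 0 < K ->
  (forall x y, enorm (g x - g y) <= K * `|x - y|) ->
  exists w : R -> R, [/\ measurable_fun setT w, (forall x, 0 <= w x) &
    {ae mu, forall t, 0 < t < 1 ->
      derivable g t 1 /\ enorm (derive1 g t) = w t}].
Proof.
move=> K0 gK.
have [w wP] := choice (fun i => lipschitz_density K0 (coord_lipschitz gK i)).
exists (fun t => Num.sqrt (\sum_(i < n) (w i t - K) ^+ 2)); split.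
- have /continuous_measurable_fun msqrt := @sqrt_continuous R.
  apply: (measurableT_comp msqrt).
  apply: measurable_sum => i.
  apply: measurable_funX; apply: measurable_funB => //.
  by have [_ /measurable_int/measurable_EFinP] := wP i.
- by move=> x; exact: sqrtr_ge0.
have aei (i : 'I_n) : {ae mu, forall t, 0 < t < 1 ->
    derivable (fun x => g x ord0 i) t 1 /\
    derive1 (fun x => g x ord0 i) t = w i t - K}.
  by have [_ _ _] := wP i.
have := @filter_forall _ _ _ _ (ae_filter_ringOfSetsType mu) aei.
apply: (@filterS _ _ (ae_filter_ringOfSetsType mu)) => t /= h t01.
have dg : derivable g t 1.
  by apply/derivable_mxP => i j; rewrite (ord1 i); case: (h j t01).
split => //; rewrite /enorm; congr Num.sqrt; apply: eq_bigr => i _.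
by rewrite derive1E derive_mx// mxE -derive1E; case: (h i t01) => _ ->.
Qed.

Lemma derive1_edot (v : 'rV[R]_n) (g : R -> 'rV[R]_n) (t : R) :
  derivable g t 1 ->
  derive1 (fun x => edot v (g x)) t = edot v (derive1 g t).
Proof.
move=> dg; have dgi i : derivable (fun x => g x ord0 i) t 1.
  by have /derivable_mxP := dg; exact.
rewrite !derive1E derive_mx//.
have -> : (fun x => edot v (g x)) = \sum_(i < n) (v ord0 i *: (fun x => g x ord0 i)).
  by apply/funext => x; rewrite fct_sumE.
rewrite derive_sum; last by move=> i; exact: derivableZ.
by apply: eq_bigr => i _; rewrite deriveZ// mxE.
Qed.

(** Testing against the direction [v] of the displacement reduces the claim to
    the scalar function [v . g], whose derivative is at most [|v| c]. *)
Lemma constant_speed_lipschitz (g : R -> 'rV[R]_n) (K c : R) : 0 < K -> 0 <= c ->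
  (forall x y, enorm (g x - g y) <= K * `|x - y|) ->
  {ae mu, forall t, 0 < t < 1 -> enorm (derive1 g t) = c} ->
  forall s t : R, 0 <= s -> s <= t -> t <= 1 ->
    enorm (g t - g s) <= c * (t - s).
Proof.
move=> K0 c0 gK gc s t s0 st t1.
set v := g t - g s.
have [v0|v0] := eqVneq (enorm v) 0.
  by rewrite v0 mulr_ge0// subr_ge0.
have vgt0 : 0 < enorm v by rewrite lt0r v0 enorm_ge0.
rewrite -(ler_pM2l vgt0) -expr2 sqr_enorm {2}/v edotBr mulrA.
apply: (@growth_le _ (fun x => edot v (g x)) (enorm v * K)) => //.
- by rewrite mulr_gt0.
- by rewrite mulr_ge0 ?enorm_ge0.
- exact: edot_lipschitz.
have [w [_ _]] := lipschitz_speed K0 gK.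
apply: (@filterS2 _ _ (ae_filter_ringOfSetsType mu) _ _ _ _ gc) => x /= cx dx x01.
rewrite derive1_edot; last by case: (dx x01).
by rewrite -(cx x01) edot_le.
Qed.

End constant_speed_theory.

(** * Inferior limits, and integrals of nonmeasurable functions *)

Section liminf_theory.
Context {R : realType}.
Implicit Types (u v : (\bar R)^nat) (l x : \bar R).
Local Open Scope ereal_scope.

Lemma einfs_le_limn_einf u n : einfs u n <= limn_einf u.
Proof.
have /cvg_lim := @cvg_einfs_sup _ u; rewrite limn_einf_lim => -> //.
by apply: ereal_sup_ubound; exists n.
Qed.

Lemma einfs_le u n : einfs u n <= u n.
Proof. by apply: ereal_inf_lbound; exists n => //=. Qed.

Lemma limn_einf_le u l : (forall n, u n <= l) -> limn_einf u <= l.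
Proof.
move=> ul; rewrite limn_einf_lim; apply: lime_le; first exact: is_cvg_einfs.
by apply: nearW => n; rewrite (le_trans (einfs_le u n)).
Qed.

Lemma limn_einf_ge u (x : R) :
  (forall e : R, (0 < e)%R -> \forall j \near \oo, x%:E <= u j + e%:E) ->
  x%:E <= limn_einf u.
Proof.
move=> h; apply/lee_addgt0Pr => e /h[N _ Nu].
rewrite -leeBlDr// (le_trans _ (einfs_le_limn_einf u N))//.
by apply: le_ereal_inf_tmp => _ [m Nm <-]; rewrite leeBlDr// Nu.
Qed.

Lemma le_limn_einf u v : (forall n, u n <= v n) -> limn_einf u <= limn_einf v.
Proof.
move=> uv; rewrite !limn_einf_lim.
apply: lee_lim; [exact: is_cvg_einfs|exact: is_cvg_einfs|].
apply: nearW => n; apply: le_ereal_inf_tmp => _ [m /= nm <-].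
by rewrite (le_trans _ (uv m))//; apply: ereal_inf_lbound; exists m.
Qed.

Lemma limn_einf_ge0 u : (forall n, 0 <= u n) -> 0 <= limn_einf u.
Proof.
move=> u0; rewrite (le_trans _ (einfs_le_limn_einf u 0%N))//.
by apply: le_ereal_inf_tmp => _ [m /= nm <-].
Qed.

Lemma limn_einfD_ge u v : (forall n, 0 <= u n) -> (forall n, 0 <= v n) ->
  limn_einf u + limn_einf v <= limn_einf (fun n => u n + v n).
Proof.
move=> u0 v0; rewrite !limn_einf_lim -limeD; [|exact: is_cvg_einfs..|]; last first.
  by apply: ge0_adde_def; rewrite inE -limn_einf_lim limn_einf_ge0.
apply: lee_lim; last 2 first.
- exact: is_cvg_einfs.
- apply: nearW => n; apply: le_ereal_inf_tmp => _ [m /= nm <-].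
  by apply: leeD; apply: ereal_inf_lbound; exists m.
apply: ereal_nondecreasing_is_cvgn => m n mn.
by apply: leeD; apply: nondecreasing_einfs.
Qed.

Lemma limn_einf_sum_ge (M : nat) (u : nat -> (\bar R)^nat) :
  (forall i n, 0 <= u i n) ->
  \sum_(i < M) limn_einf (u i) <= limn_einf (fun n => \sum_(i < M) u i n).
Proof.
move=> u0; elim: M => [|M ih].
  by rewrite big_ord0; apply: limn_einf_ge0 => n; rewrite big_ord0.
rewrite big_ord_recr/= (le_trans (leeD2r _ ih))//.
rewrite (le_trans (limn_einfD_ge _ _))//; first by move=> n; exact: sume_ge0.
by apply: le_limn_einf => n; rewrite big_ord_recr.
Qed.

Lemma limn_einfZl_ge u (r : R) : (0 < r)%R -> (forall n, 0 <= u n) ->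
  r%:E * limn_einf u <= limn_einf (fun n => r%:E * u n).
Proof.
move=> r0 u0; rewrite muleC -lee_pdivlMr// limn_einf_lim.
apply: lime_le; first exact: is_cvg_einfs.
apply: nearW => n; rewrite lee_pdivlMr// (le_trans _ (einfs_le_limn_einf _ n))//.
apply: le_ereal_inf_tmp => _ [m /= nm <-]; rewrite muleC lee_wpmul2l//.
  by rewrite lee_fin ltW.
by apply: ereal_inf_lbound; exists m.
Qed.

End liminf_theory.

Section integral_comparison.
Context d (T : measurableType d) (R : realType).
Variables (mu : {measure set T -> \bar R}) (D : set T).
Hypothesis mD : measurable D.
Local Open Scope ereal_scope.
Implicit Types f g : T -> \bar R.

(** The integral of a nonnegative function is a supremum over the simple
    functions below it, hence monotone without any measurability. This matters
    for the integrand of [path_length], whose derivative is controlled only up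
    to a null set of times. *)
Lemma ge0_le_integral_nonmeasurable f g : (forall x, D x -> 0 <= f x) ->
  (forall x, D x -> f x <= g x) ->
  \int[mu]_(x in D) f x <= \int[mu]_(x in D) g x.
Proof.
move=> f0 fg; rewrite !ge0_integralE//; last first.
  by move=> x Dx; rewrite (le_trans (f0 x Dx))// fg.
apply: ge_ereal_sup => _ [h /= hf <-]; apply: ereal_sup_ubound; exists h => //= x.
rewrite (le_trans (hf x))//; apply: lee_restrict => //.
Qed.

(** The exceptional null set is absorbed in the measurable side, here [g] and
    in the next lemma [f], by changing its values there. *)
Lemma ae_ge0_le_integral_measurable_r f g : (forall x, D x -> 0 <= f x) ->
  (forall x, D x -> 0 <= g x) -> measurable_fun D g ->
  {ae mu, forall x, D x -> f x <= g x} ->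
  \int[mu]_(x in D) f x <= \int[mu]_(x in D) g x.
Proof.
move=> f0 g0 mg [N [mN N0 fgN]].
pose g' x := if x \in N then +oo else g x.
apply: (@le_trans _ _ (\int[mu]_(x in D) g' x)).
  apply: ge0_le_integral_nonmeasurable => // x Dx; rewrite /g'.
  case: ifPn => [_|]; first exact: leey.
  by rewrite notin_setE => Nx; apply: contrapT => h; apply: Nx; apply: fgN => /= /(_ Dx).
rewrite le_eqVlt; apply/orP; left; apply/eqP.
apply: ge0_ae_eq_integral => //.
- apply: measurable_fun_if => //.
  + by apply: (measurable_fun_bool true); rewrite preimage_mem_true; exact: measurableI.
  + by apply: measurable_funS mg => // x [].
- by move=> x Dx; rewrite /g'; case: ifP => // _; exact: g0.
- exists N; split => // x /= h; apply: contrapT => Nx; apply: h => Dx.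
  by rewrite /g' memNset.
Qed.

Lemma ae_ge0_le_integral_measurable_l f g : (forall x, D x -> 0 <= f x) ->
  (forall x, D x -> 0 <= g x) -> measurable_fun D f ->
  {ae mu, forall x, D x -> f x <= g x} ->
  \int[mu]_(x in D) f x <= \int[mu]_(x in D) g x.
Proof.
move=> f0 g0 mf [N [mN N0 fgN]].
pose f' x := if x \in N then 0 else f x.
apply: (@le_trans _ _ (\int[mu]_(x in D) f' x)); last first.
  apply: ge0_le_integral_nonmeasurable => [x Dx|x Dx]; rewrite /f'.
    by case: ifPn => // _; exact: f0.
  case: ifPn => [_|]; first exact: g0.
  by rewrite notin_setE => Nx; apply: contrapT => h; apply: Nx; apply: fgN => /= /(_ Dx).
rewrite le_eqVlt; apply/orP; left; apply/eqP.
apply: ge0_ae_eq_integral => //.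
- apply: measurable_fun_if => //.
  + by apply: (measurable_fun_bool true); rewrite preimage_mem_true; exact: measurableI.
  + by apply: measurable_funS mf => // x [].
- by move=> x Dx; rewrite /f'; case: ifP => // _; exact: f0.
- exists N; split => // x /= h; apply: contrapT => Nx; apply: h => Dx.
  by rewrite /f' memNset.
Qed.

End integral_comparison.

(** * Difference quotients and densities over straddling intervals *)

Section local_behaviour.
Context {R : realType}.
Notation mu := (@lebesgue_measure R).

(** Split [[a, b]] at [t] and apply the definition of the derivative on both
    sides. *)
Lemma derivable_straddle n (g : R -> 'rV[R]_n) (t e : R) :
  derivable g t 1 -> 0 < e -> exists2 d : R, 0 < d &
    forall a b, a <= t -> t <= b -> b - a < d ->
      enorm (derive1 g t) * (b - a) <= enorm (g b - g a) + e * (b - a).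
Proof.
move=> dg e0; set D := derive1 g t.
have n0 : 0 < n%:R + 1 :> R by rewrite ltr_wpDl.
have e'0 : 0 < e / (n%:R + 1) by rewrite divr_gt0.
have : (h^-1 *: ((g \o shift t) (h *: 1) - g t)) @[h --> 0^'] --> D.
  by rewrite /D derive1E.
move/cvgrPdist_lt => /(_ _ e'0) [d /= d0 dP].
have key h : `|h| < d -> enorm (h *: D - (g (h + t) - g t)) <= e * `|h|.
  move=> hd; have [->|h0] := eqVneq h 0.
    by rewrite scale0r !add0r subrr oppr0 enorm0 normr0 mulr0.
  have := dP h; rewrite /ball_/= sub0r normrN => /(_ hd h0).
  rewrite /GRing.scale/= mulr1 => Dh.
  have -> : h *: D - (g (h + t) - g t) = h *: (D - h^-1 *: (g (h + t) - g t)).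
    by rewrite scalerBr scalerA divff// scale1r.
  rewrite enormZ mulrC ler_wpM2r//.
  rewrite (le_trans (enorm_le_norm _))//.
  rewrite (le_trans (ler_wpM2l (ler0n _ _) (ltW Dh)))//.
  by rewrite mulrA ler_pdivrMr// mulrC ler_wpM2l ?(ltW e0)// lerDl.
exists d => // a b at_ tb bad.
have hb : `|b - t| < d by rewrite ger0_norm ?subr_ge0//; lra.
have ha : `|a - t| < d by rewrite ler0_norm ?subr_le0//; lra.
have := key _ hb; have := key _ ha; rewrite !subrK.
rewrite (ger0_norm (_ : 0 <= b - t)) ?subr_ge0// (ler0_norm (_ : a - t <= 0)) ?subr_le0//.
set u := (a - t) *: D - _; set v := (b - t) *: D - _ => ua vb.
have E : (b - a) *: D = (g b - g a) + (v - u).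
  rewrite /v /u; apply/rowP => i; rewrite !mxE; ring.
have ab : 0 <= b - a by lra.
have := ler_enormD (g b - g a) (v - u); rewrite -E enormZ ger0_norm// mulrC.
have := ler_enormD v (- u); rewrite enormN; lra.
Qed.

(** Lebesgue's density theorem is about balls centred at [t]; [[a, b]] lies in
    the ball of radius [2 (b - a)], which is only four times as long. *)
Lemma density_straddle (P : set R) : measurable P ->
  {ae mu, forall t, ~ P t -> forall e : R, 0 < e -> exists2 d : R, 0 < d &
    forall a b, a <= t -> t <= b -> a < b -> b - a < d ->
      (mu (`[a, b] `&` P) <= (e * (b - a))%:E)%E}.
Proof.
move=> mP; have := lebesgue_density mP.
apply: (@filterS _ _ (ae_filter_ringOfSetsType mu)) => t /= h nPt e e0.
move: h; rewrite indicE memNset// => h.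
have e4 : 0 < e / 4 by rewrite divr_gt0.
have [d /= d0 dP] := h _ (@nbhs_open_ereal_lt _ 0 (fun=> e / 4) e4).
exists (d / 2); first by rewrite divr_gt0.
move=> a b at_ tb ab bad.
have r0 : 0 < 2 * (b - a) by lra.
have := dP (2 * (b - a)); rewrite /ball_/= sub0r normrN gtr0_norm//.
have rd : 2 * (b - a) < d by lra.
move=> /(_ rd r0).
rewrite lebesgue_measure_ball; last exact: ltW.
rewrite inver gt_eqF ?mulrn_wgt0//.
rewrite lte_pdivrMr ?mulrn_wgt0// => muP.
apply: (@le_trans _ _ (mu (P `&` ball t (2 * (b - a))))).
  apply: le_measure; rewrite ?inE; [exact: measurableI| |].
    by apply: measurableI => //; exact: measurable_ball.
  move=> x [/=]; rewrite in_itv/= => /andP[ax xb] Px; split => //.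
  rewrite /ball/= ltr_norml; apply/andP; split; lra.
rewrite (le_trans (ltW muP))// -EFinM lee_fin.
by rewrite -mulr_natl; lra.
Qed.

End local_behaviour.

(** * Lower semicontinuity of the length outside a set of finite measure *)

Section level.
Context {R : realType} {n : nat}.
Notation mu := (@lebesgue_measure R).
Local Open Scope ereal_scope.

Lemma lebesgue_measure_itv_ccD (s t : R) (X : set R) : measurable X ->
  mu (`[s, t] `\` X) <= mu (`]s, t] `\` X).
Proof.
move=> mX; have mD : measurable (`]s, t] `\` X) by exact: measurableD.
apply: (@le_trans _ _ (mu ([set s] `|` (`]s, t] `\` X)))).
  apply: le_measure; rewrite ?inE; [exact: measurableD|exact: measurableU|].
  move=> x [/= + nXx]; rewrite in_itv/= => /andP[sx xt].
  move: sx; rewrite le_eqVlt => /predU1P[<-|sx]; first by left.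
  by right; split => //=; rewrite in_itv/= sx.
have h : mu ([set s] `|` (`]s, t] `\` X)) <= mu [set s] + mu (`]s, t] `\` X).
  by apply: measureU2.
by rewrite (le_trans h)// lebesgue_measure_set1 add0e.
Qed.

Definition node (N i : nat) : R := (i%:R / N.+1%:R)%R.

Lemma node0 N : node N 0 = 0%R. Proof. by rewrite /node mul0r. Qed.

Lemma node_last N : node N N.+1 = 1%R.
Proof. by rewrite /node divff// pnatr_eq0. Qed.

Lemma nodeS N i : (node N i.+1 - node N i = N.+1%:R^-1)%R.
Proof. by rewrite /node -mulrBl -natr1 addrAC subrr add0r mul1r. Qed.

Lemma ltr_nodeS N i : (node N i < node N i.+1)%R.
Proof. by rewrite -subr_gt0 nodeS invr_gt0. Qed.

Lemma node_ge0 N i : (0 <= node N i)%R.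
Proof. by rewrite divr_ge0. Qed.

Lemma sum_measure_nodes N m (X : set R) : measurable X ->
  \sum_(i < m) mu (`]node N i, node N i.+1] `\` X) = mu (`]0%R, node N m] `\` X).
Proof.
move=> mX; elim: m => [|m ih].
  by rewrite big_ord0 node0 set_itvoc0 set0D measure0.
rewrite big_ord_recr/= ih -measureU; [|exact: measurableD|exact: measurableD|].
  rewrite -setDUl; congr (mu (_ `\` _)).
  by rewrite -itv_bndbnd_setU//= bnd_simp ?node_ge0// ltW ?ltr_nodeS.
apply/seteqP; split => // x [[/= + _] [/= + _]].
by rewrite !in_itv/= => /andP[_ xm] /andP[+ _]; rewrite ltNge xm.
Qed.

Variables (A : set 'rV[R]_n) (gs : nat -> R -> 'rV[R]_n) (g : R -> 'rV[R]_n).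
Variables (c : nat -> R) (C : R).
Hypothesis Aoo : hausdorff1 A < +oo.
Hypothesis c0 : forall j, (0 <= c j)%R.
Hypothesis C0 : (0 <= C)%R.
Hypothesis gsc : forall j x y, (enorm (gs j x - gs j y) <= c j * `|x - y|)%R.
Hypothesis gC : forall x y, (enorm (g x - g y) <= C * `|x - y|)%R.
Hypothesis gsg : forall r : R, (0 < r)%R ->
  \forall j \near \oo, forall x, (enorm (gs j x - g x) < r)%R.
Hypothesis mP : measurable (g @^-1` A).
Hypothesis mPs : forall j, measurable (gs j @^-1` A).

(** An asymptotic lower bound for the length of [gs j] outside [A] on the
    [i]-th of [N.+1] equal subintervals of [[0, 1]]. *)
Definition uncovered (N i : nat) : R :=
  Num.max 0%R (enorm (g (node N i.+1) - g (node N i)) -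
    C * fine (mu (`[node N i, node N i.+1] `&` g @^-1` A)))%R.

Lemma uncovered_ge0 N i : (0 <= uncovered N i)%R.
Proof. by rewrite le_max lexx. Qed.

Lemma measure_itv_fin_num (s t : R) (X : set R) : measurable X ->
  mu (`[s, t] `&` X) \is a fin_num.
Proof.
move=> mX; rewrite ge0_fin_numE//.
apply: (@le_lt_trans _ _ (mu `[s, t])).
  by apply: le_measure; rewrite ?inE//; exact: measurableI.
by rewrite lebesgue_measure_itv/=; case: ifP; rewrite ltry.
Qed.

(** [near_displacement_le] on each subinterval, with the same share of the
    error [e]. *)
Lemma sum_uncovered_le N : (\sum_(i < N.+1) uncovered N i)%:E <=
  limn_einf (fun j => (c j)%:E * mu (`]0%R, 1%R] `\` gs j @^-1` A)).
Proof.
apply: limn_einf_ge => e e0.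
have e'0 : (0 < e / N.+1%:R)%R by rewrite divr_gt0.
have near_i (i : 'I_N.+1) : \forall j \near \oo, (uncovered N i)%:E <=
    (c j)%:E * mu (`]node N i, node N i.+1] `\` gs j @^-1` A) + (e / N.+1%:R)%:E.
  have := near_displacement_le Aoo c0 C0 gsc gC gsg (ltW (ltr_nodeS N i)) e'0.
  apply: filterS => j h.
  rewrite /uncovered EFin_max ge_max; apply/andP; split.
    apply: adde_ge0; last by rewrite lee_fin ltW.
    by apply: mule_ge0; [rewrite lee_fin|exact: measure_ge0].
  rewrite EFinB leeBlDr// [(C * _)%:E]EFinM fineK; last exact: measure_itv_fin_num.
  rewrite (le_trans h)// addeAC leeD2r//.
  by rewrite leeD2r// lee_wpmul2l ?lee_fin// lebesgue_measure_itv_ccD.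
have : \forall j \near \oo, forall i : 'I_N.+1, (uncovered N i)%:E <=
    (c j)%:E * mu (`]node N i, node N i.+1] `\` gs j @^-1` A) + (e / N.+1%:R)%:E.
  by apply: filter_forall; exact: near_i.
apply: filterS => j h.
rewrite -sumEFin (le_trans (lee_sum _ (fun i _ => h i)))//.
rewrite big_split/= -ge0_sume_distrr//.
rewrite sum_measure_nodes// node_last leeD2l//.
by rewrite sumEFin lee_fin sumr_const card_ord -[leLHS]mulr_natr divfK// pnatr_eq0.
Qed.

(** The step function with integral [uncovered N i] on the [i]-th
    subinterval. *)
Definition uncovered_speed (N : nat) (t : R) : R :=
  (\sum_(i < N.+1) uncovered N i * N.+1%:R *
     \1_(`]node N i, node N i.+1]%classic) t)%R.

Lemma uncovered_speed_ge0 N t : (0 <= uncovered_speed N t)%R.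
Proof. by apply: sumr_ge0 => i _; rewrite !mulr_ge0// uncovered_ge0. Qed.

Lemma measurable_uncovered_speed N D : measurable_fun D (uncovered_speed N).
Proof.
apply: measurable_sum => i; apply: measurable_funM => //.
Qed.

Lemma integral_uncovered_speed N (D : set R) : measurable D ->
  \int[mu]_(t in D) (uncovered_speed N t)%:E <=
  (\sum_(i < N.+1) uncovered N i)%:E.
Proof.
move=> mD; under eq_integral do rewrite -sumEFin.
rewrite ge0_integral_sum//; last 2 first.
- by move=> i; apply/measurable_EFinP; apply: measurable_funM => //.
- by move=> i x _; rewrite lee_fin !mulr_ge0// uncovered_ge0.
rewrite -sumEFin; apply: lee_sum => i _.
have u0 := uncovered_ge0 N i.
under eq_integral do rewrite EFinM.
rewrite ge0_integralZl//; last 2 first.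
- by apply/measurable_EFinP; exact: measurable_indic.
- by rewrite lee_fin mulr_ge0.
rewrite integral_indic//.
apply: (@le_trans _ _ ((uncovered N i * N.+1%:R)%:E * mu `]node N i, node N i.+1])).
  rewrite lee_wpmul2l ?lee_fin ?mulr_ge0//.
  by apply: le_measure; rewrite ?inE//; exact: measurableI.
rewrite lebesgue_measure_itv/= lte_fin ltr_nodeS -EFinB nodeS -EFinM.
by rewrite -mulrA divff ?mulr1// pnatr_eq0.
Qed.

Variable w : R -> R.
Hypothesis w0 : forall t, (0 <= w t)%R.
Hypothesis mw : measurable_fun setT w.
Hypothesis wg : {ae mu, forall t, (0 < t < 1)%R ->
  derivable g t 1%R /\ enorm (derive1 g t) = w t}.

(** Near a time at which [g] is differentiable and [g @^-1` A] has density
    zero, the displacement per unit of time is at least [w t - e1] and the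
    correction at most [C * e2], where [e1] and [C * e2] are at most [e / 2]. *)
Lemma ae_speed_le_uncovered : {ae mu, forall t,
  (`]0%R, 1%R[ `\` g @^-1` A) t ->
  (w t)%:E <= limn_einf (fun N => (uncovered_speed N t)%:E)}.
Proof.
have := density_straddle mP.
apply: (@filterS2 _ _ (ae_filter_ringOfSetsType mu) _ _ _ _ wg).
move=> t /= dgt dent [+ nAt]; rewrite in_itv/= => t01.
have [dg <-] := dgt t01.
apply: limn_einf_ge => e e0.
pose e1 := (e / 2)%R; pose e2 := (e / (2 * (C + 1)))%R.
have C1 : (0 < C + 1)%R by rewrite ltr_wpDl.
have e10 : (0 < e1)%R by rewrite divr_gt0.
have e20 : (0 < e2)%R by rewrite divr_gt0// mulr_gt0.
have Ce2 : (C * e2 <= e / 2)%R.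
  rewrite (_ : C * e2 = e / 2 * (C / (C + 1)))%R; last first.
    by rewrite /e2; field; rewrite gt_eqF.
  by rewrite ler_piMr ?(ltW e10)// ler_pdivrMr// mul1r lerDl.
have [d1 d10 h1] := derivable_straddle dg e10.
have [d2 d20 h2] := dent nAt _ e20.
have d0 : (0 < Num.min d1 d2)%R by rewrite lt_min d10.
have [N0 N0d] := ltr_add_invr d0; rewrite add0r in N0d.
exists N0 => // N /= N0N.
have Nd : (N.+1%:R^-1 < Num.min d1 d2)%R.
  by rewrite (le_lt_trans _ N0d)// lef_pV2 ?posrE// ler_nat.
have /andP[Nd1 Nd2] : ((N.+1%:R^-1 < d1) && (N.+1%:R^-1 < d2))%R by rewrite -lt_min.
(* the subinterval that contains [t] *)
have ex : exists i, (t <= node N i)%R.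
  by exists N.+1; rewrite node_last; case/andP: t01 => _ /ltW.
case: (ex_minnP ex) => -[|i] ti imin.
  by move: ti; rewrite node0 leNgt; case/andP: t01 => ->.
have it : (node N i < t)%R.
  by rewrite ltNge; apply/negP => /imin; rewrite ltnn.
have iN : (i < N.+1)%N.
  rewrite -ltnS; apply: (@leq_ltn_trans N.+1) => //.
  by apply: imin; rewrite node_last; case/andP: t01 => _ /ltW.
have := h1 _ _ (ltW it) ti; rewrite nodeS => /(_ Nd1) {}h1.
have := h2 _ _ (ltW it) ti (ltr_nodeS N i); rewrite nodeS => /(_ Nd2) {}h2.
rewrite -EFinD lee_fin.
have le_i : (uncovered N i * N.+1%:R <= uncovered_speed N t)%R.
  rewrite /uncovered_speed (bigD1 (Ordinal iN))//= indicE mem_set ?mulr1; last first.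
    by rewrite /= in_itv/= it ti.
  by rewrite lerDl sumr_ge0// => k _; rewrite !mulr_ge0// uncovered_ge0.
rewrite -lerBlDr (le_trans _ le_i)// -ler_pdivrMr//.
rewrite le_max; apply/orP; right.
rewrite -[mu _]fineK ?lee_fin in h2; last exact: measure_itv_fin_num.
rewrite mulrBl.
have := ler_wpM2l C0 h2; rewrite mulrA.
have N1 : (0 < N.+1%:R^-1 :> R)%R by rewrite invr_gt0.
have := ler_wpM2r (ltW N1) Ce2.
move: h1; rewrite /e1; set X := fine _; set h := (N.+1%:R^-1)%R; nra.
Qed.

Lemma integral_uncovered_le_liminf :
  \int[mu]_(t in `]0%R, 1%R[ `\` g @^-1` A) (w t)%:E <=
  limn_einf (fun j => (c j)%:E * mu (`]0%R, 1%R] `\` gs j @^-1` A)).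
Proof.
have mD : measurable (`]0%R, 1%R[ `\` g @^-1` A) by exact: measurableD.
pose F N t := (uncovered_speed N t)%:E.
have mF N : measurable_fun (`]0%R, 1%R[ `\` g @^-1` A) (F N).
  by apply/measurable_EFinP; exact: measurable_uncovered_speed.
have F0 N t : 0 <= F N t by rewrite lee_fin uncovered_speed_ge0.
apply: (@le_trans _ _ (\int[mu]_(t in `]0%R, 1%R[ `\` g @^-1` A)
    limn_einf (F^~ t))).
  apply: ae_ge0_le_integral_measurable_l => //.
  - by move=> t _; rewrite lee_fin.
  - by move=> t _; apply: limn_einf_ge0 => N; exact: F0.
  - by apply/measurable_EFinP; exact: measurable_funTS.
  - exact: ae_speed_le_uncovered.
have h := @fatou _ _ _ mu _ mD F mF (fun N t _ => F0 N t).
apply: (le_trans h).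
apply: limn_einf_le => N.
exact: le_trans (integral_uncovered_speed N mD) (sum_uncovered_le N).
Qed.

End level.

(** * Layers of the cost *)

Section layer_cake.
Context {R : realType}.
Local Open Scope ereal_scope.

(** A lower Riemann sum, with step [h], for the layer-cake formula
    [x = \int_0^oo 1_(l < x) dl]. *)
Definition layers (h : R) (M : nat) (x : \bar R) : R :=
  (\sum_(i < M) h * ((i.+1%:R * h)%:E < x)%E%:R)%R.

Lemma layers_ge0 (h : R) M x : (0 <= h)%R -> (0 <= layers h M x)%R.
Proof. by move=> h0; apply: sumr_ge0 => i _; rewrite mulr_ge0. Qed.

Lemma layersS (h : R) M x : layers h M.+1 x =
  (layers h M x + h * ((M.+1%:R * h)%:E < x)%E%:R)%R.
Proof. by rewrite /layers big_ord_recr. Qed.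

Lemma layers_full (h : R) M x : (0 <= h)%R ->
  (M%:R * h)%:E < x -> layers h M x = (M%:R * h)%R.
Proof.
move=> h0; elim: M => [|M ih] Mx; first by rewrite /layers big_ord0 mul0r.
rewrite layersS Mx ih; first by rewrite mulr1 -natr1 mulrDl mul1r.
by rewrite (le_lt_trans _ Mx)// lee_fin ler_wpM2r// ler_nat.
Qed.

Lemma layers_le (h : R) M x : (0 <= h)%R -> 0 <= x -> (layers h M x)%:E <= x.
Proof.
move=> h0 x0; elim: M => [|M ih]; first by rewrite /layers big_ord0.
have [Mx|Mx] := ltP (M.+1%:R * h)%:E x; first by rewrite layers_full// ltW.
by rewrite layersS ltNge Mx mulr0 addr0.
Qed.

Lemma layers_ge (h : R) M (r : R) x : (0 <= h)%R -> r%:E <= x ->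
  (Num.min r (M.+1%:R * h) - h <= layers h M x)%R.
Proof.
move=> h0 rx; elim: M => [|M ih].
  by rewrite /layers big_ord0 subr_le0 mul1r ge_min lexx orbT.
have [Mr|rM] := ltP (M.+1%:R * h)%R r.
  rewrite layers_full//; last by rewrite (lt_le_trans _ rx).
  rewrite lerBlDr -[X in (_ <= _ + X)%R]mul1r -mulrDl natr1.
  by rewrite ge_min lexx orbT.
rewrite layersS (le_trans (_ : _ <= r - h)%R)//.
  by rewrite lerD2r ge_min lexx.
move: ih; rewrite (min_idPl rM) => ih.
by rewrite (le_trans ih)// lerDl mulr_ge0.
Qed.

(** The step [1/(k+1)] and the [(k+1)^2] layers, up to height [k+1], make the
    lower sums converge. *)
Definition fine_layers (k : nat) (x : \bar R) : R :=
  layers k.+1%:R^-1 (k.+1 ^ 2) x.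

Lemma fine_layers_ge0 k x : (0 <= fine_layers k x)%R.
Proof. by rewrite layers_ge0. Qed.

Lemma fine_layers_le k x : 0 <= x -> (fine_layers k x)%:E <= x.
Proof. by move=> x0; rewrite layers_le. Qed.

Lemma near_fine_layers (x : \bar R) (r e : R) : r%:E <= x -> (0 < e)%R ->
  \forall k \near \oo, (r <= fine_layers k x + e)%R.
Proof.
move=> rx e0; have [N Ne] := ltr_add_invr e0; rewrite add0r in Ne.
exists (maxn N (Num.bound `|r|)) => // k /=; rewrite geq_max => /andP[Nk rk].
have ke : (k.+1%:R^-1 <= e)%R.
  by rewrite (le_trans _ (ltW Ne))// lef_pV2 ?posrE// ler_nat.
have k0 : (0 <= k.+1%:R^-1 :> R)%R by [].
have rk2 : (r <= (k.+1 ^ 2).+1%:R * k.+1%:R^-1)%R.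
  rewrite (le_trans (ler_norm r))// (le_trans (ltW (archi_boundP (normr_ge0 r))))//.
  rewrite ler_pdivlMr// -natrM ler_nat ltnW// ltnS expnS expn1.
  by rewrite leq_mul2r (leq_trans rk)// leqnSn.
have := @layers_ge _ (k.+1 ^ 2) _ _ k0 rx; rewrite (min_idPl rk2) -/(fine_layers k x).
by rewrite lerBlDr => /le_trans; apply; rewrite lerD2l.
Qed.

(** The case [x = +oo], [w = 0] uses the convention [0 * +oo = 0]. *)
Lemma mule_le_liminf_layers (x : \bar R) (w : R) : 0 <= x -> (0 <= w)%R ->
  x * w%:E <= limn_einf (fun k => (fine_layers k x * w)%:E).
Proof.
move=> x0; rewrite le_eqVlt => /predU1P[<-|w0].
  by rewrite mule0; apply: limn_einf_ge0 => k; rewrite mulr0.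
have fin (r : R) : (0 <= r)%R -> r%:E <= x -> (r * w)%:E <=
    limn_einf (fun k => (fine_layers k x * w)%:E).
  move=> r0 rx; apply: limn_einf_ge => e e0.
  have ew0 : (0 < e / w)%R by rewrite divr_gt0.
  have := near_fine_layers rx ew0; apply: filterS => k rk.
  rewrite -EFinD lee_fin (le_trans (ler_wpM2r (ltW w0) rk))//.
  by rewrite mulrDl divfK// gt_eqF.
case: x x0 fin => [r x0 fin|_ fin|//]; first by rewrite -EFinM fin// -lee_fin.
rewrite gt0_mulye ?lte_fin//.
suff -> : limn_einf (fun k => (fine_layers k +oo * w)%:E) = +oo by [].
apply/eqyP => B B0; have := fin (B / w)%R.
by rewrite divfK ?gt_eqF//; apply; rewrite ?leey// divr_ge0// ltW.
Qed.

Context d (T : measurableType d) (mu : {measure set T -> \bar R}).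
Variables (D : set T) (f : T -> \bar R) (w : T -> R).
Hypothesis mD : measurable D.
Hypothesis mf : forall r : R, (0 <= r)%R -> measurable [set t | r%:E < f t].
Hypothesis mw : measurable_fun D w.
Hypothesis w0 : forall t, (0 <= w t)%R.

Let level (r : R) : set T := [set t | r%:E < f t].

Let level_indicE (r : R) :
  (fun t => (r%:E < f t)%E%:R) = \1_(level r) :> (T -> R).
Proof. by apply/funext => t; rewrite indicE mem_setE. Qed.

Lemma measurable_layers (h : R) M : (0 <= h)%R ->
  measurable_fun D (fun t => layers h M (f t)).
Proof.
move=> h0; apply: measurable_sum => i; apply: measurable_funM => //.
by rewrite level_indicE; apply: measurable_indic; apply: mf; rewrite mulr_ge0.
Qed.

Lemma integral_layers (h : R) M : (0 <= h)%R ->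
  \int[mu]_(t in D) (layers h M (f t) * w t)%:E =
  \sum_(i < M) h%:E *
    \int[mu]_(t in D `&` [set t | (i.+1%:R * h)%:E < f t]) (w t)%:E.
Proof.
move=> h0.
pose F (i : 'I_M) (t : T) := h%:E * ((w t)%:E * (\1_(level (i.+1%:R * h)%R) t)%:E).
have mL (i : 'I_M) : measurable (level (i.+1%:R * h)%R) by apply: mf; rewrite mulr_ge0.
have mF0 (i : 'I_M) : measurable_fun D
    (fun t => (w t)%:E * (\1_(level (i.+1%:R * h)%R) t)%:E).
  by apply: emeasurable_funM; apply/measurable_EFinP => //; exact: measurable_indic.
have F00 (i : 'I_M) (t : T) : 0 <= (w t)%:E * (\1_(level (i.+1%:R * h)%R) t)%:E.
  by rewrite mule_ge0// lee_fin.
transitivity (\int[mu]_(t in D) \sum_(i < M) F i t).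
  apply: eq_integral => t _; rewrite mulr_suml -sumEFin; apply: eq_bigr => i _.
  by rewrite /F -level_indicE -!EFinM mulrAC mulrA.
rewrite ge0_integral_sum//; last 2 first.
- by move=> i; apply: measurable_funeM.
- by move=> i t _; rewrite mule_ge0// lee_fin.
apply: eq_bigr => i _; rewrite ge0_integralZl//.
rewrite integral_mkcondr; congr (_ * _); apply: eq_integral => t _.
by rewrite patchE indicE; case: ifP => _; rewrite ?mule1 ?mule0.
Qed.

End layer_cake.

(** * Clamped paths, Borel levels of the cost *)

Section paths.
Context {R : realType} {n : nat}.
Notation mu := (@lebesgue_measure R).

(** Composition with [clamp] extends a path from [[0, 1]] to a path with the
    same Lipschitz constant on the whole line, without changing its derivative
    inside. *)
Definition clamp (t : R) : R := Num.max 0 (Num.min t 1).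

Lemma clamp01 t : 0 <= clamp t <= 1.
Proof. by rewrite /clamp le_max lexx/= ge_max ler01 ge_min lexx orbT. Qed.

Lemma clamp_id t : 0 <= t <= 1 -> clamp t = t.
Proof. by case/andP => t0 t1; rewrite /clamp (min_idPl t1) (max_idPr t0). Qed.

Lemma clampP t : [\/ t <= 0 /\ clamp t = 0, 0 <= t <= 1 /\ clamp t = t |
  1 <= t /\ clamp t = 1].
Proof.
have [t0|t0] := leP t 0.
  apply: Or31; split => //; rewrite /clamp; apply/max_idPl.
  by rewrite ge_min t0.
have [t1|t1] := leP t 1.
  by apply: Or32; split; [rewrite ltW|rewrite clamp_id// ltW].
apply: Or33; split; first exact: ltW.
by rewrite /clamp (min_idPr (ltW t1)) (max_idPr _).
Qed.

Lemma clamp_dist s t : `|clamp s - clamp t| <= `|s - t|.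
Proof.
have := ler_norm (s - t); have := ler_norm (t - s); rewrite (distrC t s).
rewrite ler_norml; move: (clampP s) (clampP t).
by case=> [[? ->]|[/andP[? ?] ->]|[? ->]] [[? ->]|[/andP[? ?] ->]|[? ->]] ? ?;
  apply/andP; split; lra.
Qed.

Lemma clamp_lipschitz (g : R -> 'rV[R]_n) (K : R) : 0 <= K ->
  elipschitz_in `[0, 1] K g ->
  forall x y, enorm (g (clamp x) - g (clamp y)) <= K * `|x - y|.
Proof.
move=> K0 gK x y.
have in01 t : `[0, 1]%classic (clamp t) by rewrite /= in_itv/= clamp01.
by rewrite (le_trans (gK _ _ (in01 x) (in01 y)))// ler_wpM2l// clamp_dist.
Qed.

Lemma derive1_clamp (g : R -> 'rV[R]_n) (t : R) : 0 < t < 1 ->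
  derive1 (g \o clamp) t = derive1 g t.
Proof.
move=> t01; rewrite !derive1E; apply: near_eq_derive.
have : t \in `]0, 1[ by rewrite in_itv.
move/near_in_itvoo; apply: filterS => x; rewrite in_itv/= => /andP[x0 x1].
by rewrite /= clamp_id// !ltW.
Qed.

Lemma ae_itv_oo : {ae mu, forall t, `[0, 1]%classic t -> 0 < t < 1}.
Proof.
exists [set` [:: 0; 1 : R]]; split.
- have : countable [set` [:: 0; 1 : R]] by apply: finite_set_countable; exact: finite_seq.
  exact: countable_measurable.
- by apply: countable_lebesgue_measure0; apply: finite_set_countable; exact: finite_seq.
move=> t /= /not_implyP[]; rewrite in_itv/= => /andP[t0 t1] nt.
rewrite !inE; apply: contra_notT nt; rewrite negb_or => /andP[tn0 tn1].
by rewrite !lt_neqAle t0 t1 eq_sym tn0 tn1.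
Qed.

(** Otherwise the interval would be a null set. *)
Lemma constant_speed_ge0 (g : R -> 'rV[R]_n) (c : R) :
  {ae mu, forall t, `[0, 1]%classic t -> enorm (derive1 g t) = c} -> 0 <= c.
Proof.
move=> [N [mN N0 hN]]; rewrite leNgt; apply/negP => c0.
have : (mu `[0%R, 1%R] <= mu N)%E.
  apply: le_measure; rewrite ?inE//= => t t01; apply: hN => /= /(_ t01) E.
  by move: (enorm_ge0 (derive1 g t)); rewrite E leNgt c0.
by rewrite N0 lebesgue_measure_itv/= lte_fin ltr01 -EFinB subr0 lee_fin ler10.
Qed.

Lemma borel_preimage_measurable (g : R -> 'rV[R]_n) (A : set 'rV[R]_n) :
  continuous g -> borel_set A -> measurable (g @^-1` A).
Proof.
move=> cg; apply: (@smallest_sub _ _ _ [set B | measurable (g @^-1` B)]).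
  split => [|B mB|B mB].
  - by rewrite /= preimage_set0.
  - by rewrite setTD /= preimage_setC; exact: measurableC.
  - by rewrite /mkset preimage_bigcup; apply: bigcup_measurable => k _; exact: mB.
by move=> U oU /=; apply: open_measurable; move/continuousP : cg; exact.
Qed.

Lemma borel_setD (A U : set 'rV[R]_n) : borel_set A -> open U ->
  borel_set (A `\` U).
Proof.
move=> bA oU.
apply: (@measurableD _ (g_sigma_algebraType [set V : set 'rV[R]_n | open V])) => //.
exact: sub_gen_smallest.
Qed.

Lemma sublevel_borel (S : set 'rV[R]_n) (b : 'rV[R]_n -> R) (l : R) :
  borel_set S -> lower_semicontinuous (fun z : subspace S => (b z)%:E) ->
  borel_set (sublevel S b l).
Proof.
move=> bS /lower_semicontinuousP/(_ l)/open_subspaceP[V oV VS].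
suff -> : sublevel S b l = S `\` V by exact: borel_setD.
apply/seteqP; split => z [Sz].
  move=> bzl; split => // Vz.
  have [/=] : ([set x | (l%:E < (b x)%:E)%E] `&` S) z by rewrite -VS.
  by rewrite lte_fin ltNge bzl.
move=> nVz; split => //; rewrite leNgt; apply/negP => lbz; apply: nVz.
by have [] : (V `&` S) z by rewrite VS; split => //=; rewrite lte_fin.
Qed.

Lemma uniform_near_enorm (gs : nat -> R -> 'rV[R]_n) (g : R -> 'rV[R]_n) (D : set R) :
  {uniform D, gs @ \oo --> g} ->
  forall r : R, 0 < r ->
    \forall j \near \oo, forall t, D t -> enorm (gs j t - g t) < r.
Proof.
move=> gsg r r0.
have n0 : 0 < n%:R + 1 :> R by rewrite ltr_wpDl.
have e0 : 0 < r / (n%:R + 1) by rewrite divr_gt0.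
have : nbhs (g : {uniform` D -> 'rV[R]_n})
    [set h | forall t, D t -> enorm (h t - g t) < r].
  apply/uniform_nbhs.
  exists [set xy | ball xy.1 (PosNum e0)%:num xy.2]; split.
    exact: entourage_ball.
  move=> h /= hg t Dt; have := hg t Dt; rewrite -ball_normE/= => gh.
  rewrite enorm_distC (le_lt_trans (enorm_le_norm _))//.
  rewrite (@le_lt_trans _ _ ((n%:R + 1) * `|g t - h t|))//.
    by rewrite ler_wpM2r// lerDl.
  by rewrite mulrC -ltr_pdivlMr.
by move/gsg.
Qed.

Lemma uniform_limit_lipschitz (gs : nat -> R -> 'rV[R]_n) (g : R -> 'rV[R]_n)
    (D : set R) (K : R) :
  (forall r : R, 0 < r ->
    \forall j \near \oo, forall t, D t -> enorm (gs j t - g t) < r) ->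
  (forall j, elipschitz_in D K (gs j)) -> elipschitz_in D K g.
Proof.
move=> gsg gsK s t Ds Dt; apply/ler_addgt0Pr => e e0.
have e2 : 0 < e / 2 by rewrite divr_gt0.
have [N _ /(_ N (leqnn N)) h] := gsg _ e2.
have := gsK N s t Ds Dt; have := h s Ds; have := h t Dt.
have := ler_enorm_sub (g s) (gs N s) (g t).
have := ler_enorm_sub (gs N s) (gs N t) (g t).
rewrite (enorm_distC (g s) (gs N s)); lra.
Qed.

End paths.

Section cost.
Context {R : realType} {n : nat}.
Variables (S : set 'rV[R]_n) (a : \bar R) (b : 'rV[R]_n -> R).
Hypothesis a_ge0 : (0 <= a)%E.
Hypothesis b_ge0 : forall z, S z -> 0 <= b z.
Hypothesis b_le_a : forall z, S z -> ((b z)%:E <= a)%E.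

Lemma extend_cost_ge0 z : (0 <= extend_cost S a b z)%E.
Proof. by rewrite /extend_cost; case: ifPn => // /set_mem/b_ge0; rewrite lee_fin. Qed.

Lemma extend_cost_le z : (extend_cost S a b z <= a)%E.
Proof. by rewrite /extend_cost; case: ifPn => // /set_mem/b_le_a. Qed.

Lemma superlevel_extend_cost (l : R) : (l%:E < a)%E ->
  [set z | (l%:E < extend_cost S a b z)%E] = ~` sublevel S b l.
Proof.
move=> la; apply/seteqP; split => z /=; rewrite /extend_cost.
  case: ifPn => [/set_mem Sz|/negP Sz] lz [Sz' bz].
    by rewrite lte_fin ltNge bz in lz.
  by apply: Sz; exact: mem_set.
move=> h; case: ifPn => // /set_mem Sz; rewrite lte_fin ltNge; apply/negP => bz.
by apply: h.
Qed.

Lemma superlevel_extend_cost0 (l : R) : (a <= l%:E)%E ->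
  [set z | (l%:E < extend_cost S a b z)%E] = set0.
Proof.
move=> al; apply/seteqP; split => // z /=.
by rewrite ltNge (le_trans (extend_cost_le z)).
Qed.

End cost.

(** * Lower semicontinuity of the path length *)

Lemma constant_speed_elipschitz (R : realType) (n : nat) (g : R -> 'rV[R]_n)
    (K c : R) : 0 < K -> elipschitz_in `[0, 1] K g ->
  {ae @lebesgue_measure R, forall t, `[0, 1]%classic t -> enorm (derive1 g t) = c} ->
  elipschitz_in `[0, 1] c g.
Proof.
move=> K0 gK gc.
have gK' := clamp_lipschitz (ltW K0) gK.
have gc' : {ae @lebesgue_measure R, forall t, 0 < t < 1 ->
    enorm (derive1 (g \o clamp) t) = c}.
  apply: (@filterS _ _ (ae_filter_ringOfSetsType _) _ _ _ gc) => t /= h t01.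
  by rewrite derive1_clamp// h// in_itv/= !ltW//; case/andP: t01.
have key := constant_speed_lipschitz K0 (constant_speed_ge0 gc) gK' gc'.
move=> s t /=; rewrite !in_itv/= => s01 t01.
wlog st : s t s01 t01 / s <= t.
  by move=> h; have [|/ltW] := leP s t => st; [|rewrite enorm_distC distrC]; exact: h.
have /andP[s0 _] := s01; have /andP[_ t1] := t01.
have := key s t s0 st t1; rewrite /= !clamp_id// => h.
by rewrite enorm_distC distrC ger0_norm// subr_ge0.
Qed.

Lemma measurable_fun_limn_einf d (T : measurableType d) (R : realType) (D : set T)
    (f : nat -> T -> \bar R) : (forall k, measurable_fun D (f k)) ->
  measurable_fun D (fun t => limn_einf (f^~ t)).
Proof.
move=> mf; apply: (emeasurable_fun_cvg (fun k t => einfs (f^~ t) k)).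
  exact: measurable_fun_einfs.
by move=> t _; rewrite limn_einf_lim; exact: is_cvg_einfs.
Qed.

Theorem theorem2p1p1 (R : realType) (n : nat)
    (S : set 'rV[R]_n) (a : \bar R) (b : 'rV[R]_n -> R)
    (S_cube : S `<=` @cube R n)
    (S_rect : countably_1_rectifiable S)
    (S_borel : borel_set S)
    (a_ge0 : (0 <= a)%E)
    (b_ge0 : forall z, S z -> 0 <= b z)
    (b_lsc : lower_semicontinuous (fun z : subspace S => (b z)%:E))
    (b_le_a : forall z, S z -> ((b z)%:E <= a)%E)
    (S_fin : forall l : R, 0 <= l -> (l%:E < a)%E ->
       (hausdorff1 (sublevel S b l) < +oo)%E)
    (C : R) (C_gt0 : 0 < C)
    (gs : nat -> R -> 'rV[R]_n) (g : R -> 'rV[R]_n)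
    (gs_Gamma : forall j, @Gamma R n C (gs j))
    (gs_speed : forall j, constant_speed (gs j))
    (gs_cvg : {uniform `[0, 1]%classic, gs @ \oo --> g}) :
  (path_length S a b g <= limn_einf (fun j => path_length S a b (gs j)))%E.
Proof.
set mu := @lebesgue_measure R.
pose E := extend_cost S a b.
have E0 z : (0 <= E z)%E by exact: extend_cost_ge0.
pose G := g \o clamp; pose Gs j := gs j \o clamp.
have near01 := uniform_near_enorm gs_cvg.
have gsC j : elipschitz_in `[0, 1] C (gs j) by case: (gs_Gamma j).
have gC := uniform_limit_lipschitz near01 gsC.
have C0 := ltW C_gt0.
have GC : forall x y, enorm (G x - G y) <= C * `|x - y| := clamp_lipschitz C0 gC.
have [c cP] := choice gs_speed.
have c0 j : 0 <= c j := constant_speed_ge0 (cP j).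
have Gsc j : forall x y, enorm (Gs j x - Gs j y) <= c j * `|x - y|.
  exact: clamp_lipschitz (c0 j) (constant_speed_elipschitz C_gt0 (gsC j) (cP j)).
have GsG (r : R) : 0 < r ->
    \forall j \near \oo, forall x, enorm (Gs j x - G x) < r.
  move=> r0; apply: filterS (near01 r r0) => j h x.
  by apply: h; rewrite /= in_itv/= clamp01.
have Gcont : continuous G := lipschitz_continuous C0 GC.
have Gscont j : continuous (Gs j) := lipschitz_continuous (c0 j) (Gsc j).
have [w [mw w0 wG]] := lipschitz_speed C_gt0 GC.
pose lev (f : R -> 'rV[R]_n) (l : R) := [set t : R | (l%:E < E (f t))%E].
have lev_lt (f : R -> 'rV[R]_n) l : (l%:E < a)%E -> lev f l = ~` (f @^-1` sublevel S b l).
  by move=> la; rewrite preimage_setC -(@superlevel_extend_cost _ _ S a b l la).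
have lev_ge (f : R -> 'rV[R]_n) l : (a <= l%:E)%E -> lev f l = set0.
  move=> al; rewrite -(preimage_set0 f) -(superlevel_extend_cost0 b_le_a al).
  by [].
have mpre (f : R -> 'rV[R]_n) l : continuous f -> measurable (f @^-1` sublevel S b l).
  by move=> cf; apply: borel_preimage_measurable => //; exact: sublevel_borel.
have mlev (f : R -> 'rV[R]_n) l : continuous f -> measurable (lev f l).
  move=> cf; have [la|al] := ltP l%:E a; last by rewrite lev_ge.
  by rewrite lev_lt//; apply: measurableC; exact: mpre.
(* the theorem for the cost that is 1 above level [l] and 0 below *)
have level_le (l : R) : 0 <= l ->
    (\int[mu]_(t in `]0%R, 1%R[ `&` lev G l) (w t)%:E <=
     limn_einf (fun j => (c j)%:E * mu (`]0%R, 1%R] `&` lev (Gs j) l)))%E.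
  move=> l0; have [la|al] := ltP l%:E a; last first.
    rewrite lev_ge// setI0 integral_set0; apply: limn_einf_ge0 => j.
    by rewrite mule_ge0// lee_fin.
  have := integral_uncovered_le_liminf (S_fin l l0 la) c0 C0 Gsc GC GsG
    (mpre _ l Gcont) (fun j => mpre _ l (Gscont j)) w0 mw wG.
  by rewrite lev_lt// -setDE; under [X in limn_einf X]eq_fun => j do
    rewrite setDE -lev_lt//.
pose F k t := (fine_layers k (E (G t)) * w t)%:E.
have F0 k t : (0 <= F k t)%E by rewrite lee_fin mulr_ge0// fine_layers_ge0.
have mF k (D : set R) : measurable_fun D (F k).
  apply: measurable_funTS; apply/measurable_EFinP; apply: measurable_funM => //.
  by apply: measurable_layers => // r _; exact: (mlev G).
(* the lower sums bound the lengths of [gs j] from below; as the speed of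
   [gs j] is the constant [c j], they are expressed by times only *)
have lower k j : ((\sum_(i < k.+1 ^ 2) (k.+1%:R^-1)%:E *
    ((c j)%:E * mu (`]0%R, 1%R] `&` lev (Gs j) (i.+1%:R * k.+1%:R^-1)%R))) <=
    path_length S a b (gs j))%E.
  apply: (@le_trans _ _ (\int[mu]_(t in `[0%R, 1%R])
      (fine_layers k (E (Gs j t)) * c j)%:E)%E).
    rewrite integral_layers//; last by move=> r _; exact: (mlev (Gs j)).
    apply: lee_sum => i _; apply: lee_wpmul2l; first by rewrite lee_fin.
    rewrite integral_cst//; last by apply: measurableI => //; exact: (mlev (Gs j)).
    apply: lee_wpmul2l; first by rewrite lee_fin.
    apply: le_measure; rewrite ?inE.
    - by apply: measurableI => //; exact: (mlev (Gs j)).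
    - by apply: measurableI => //; exact: (mlev (Gs j)).
    - by apply: setSI; exact: subset_itv_oc_cc.
  apply: ae_ge0_le_integral_measurable_l => //.
  - by move=> t _; rewrite lee_fin mulr_ge0// fine_layers_ge0.
  - by move=> t _; rewrite mule_ge0// lee_fin enorm_ge0.
  - apply/measurable_EFinP; apply: measurable_funM => //.
    by apply: measurable_layers => // r _; exact: (mlev (Gs j)).
  apply: (@filterS _ _ (ae_filter_ringOfSetsType _) _ _ _ (cP j)) => t /= h t01.
  rewrite h// EFinM lee_wpmul2r ?lee_fin// /Gs/= clamp_id; last by move: t01; rewrite in_itv.
  exact: fine_layers_le.
apply: (@le_trans _ _ (\int[mu]_(t in `[0%R, 1%R]) limn_einf (F^~ t))%E).
  apply: ae_ge0_le_integral_measurable_r => //.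
  - by move=> t _; rewrite mule_ge0// lee_fin enorm_ge0.
  - by move=> t _; apply: limn_einf_ge0 => k; exact: F0.
  - by apply: measurable_fun_limn_einf => k; exact: mF.
  apply: (@filterS2 _ _ (ae_filter_ringOfSetsType _) _ _ _ _ wG (@ae_itv_oo R)).
  move=> t /= wt oo t01.
  have {}t01 := oo t01.
  have [_] := wt t01; rewrite derive1_clamp// => ->.
  have -> : g t = G t by rewrite /G/= clamp_id//; case/andP: t01 => *; rewrite !ltW.
  exact: mule_le_liminf_layers.
rewrite integral_itv_bndoo; last by apply: measurable_fun_limn_einf => k; exact: mF.
have h := @fatou _ _ _ mu `]0%R, 1%R[%classic (measurable_itv _) F
  (fun k => mF k _) (fun k t _ => F0 k t).
apply: (le_trans h); apply: limn_einf_le => k.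
rewrite integral_layers//; [|by move=> r _; exact: (mlev G)|exact: measurable_funTS].
pose u i j := ((k.+1%:R^-1)%:E *
  ((c j)%:E * mu (`]0%R, 1%R] `&` lev (Gs j) (i.+1%:R * k.+1%:R^-1)%R)))%E.
apply: (@le_trans _ _ (\sum_(i < k.+1 ^ 2) limn_einf (u i))%E).
  apply: lee_sum => i _.
  rewrite (le_trans _ (limn_einfZl_ge _ _))//.
  - by apply: lee_wpmul2l; [rewrite lee_fin|apply: level_le].
  - by move=> j; rewrite mule_ge0// lee_fin.
rewrite (le_trans (limn_einf_sum_ge _ _))//.
  by move=> i j; rewrite !mule_ge0// lee_fin.
by apply: le_limn_einf => j; exact: lower.
Qed.
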